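(* Let $H$ be an infinite-dimensional complex Hilbert space and $B(H)$ the algebra of all bounded linear operators on $H$. Fix an arbitrary orthonormal basis of $H$, and let $A^t$ denote the transpose of $A\in B(H)$ with respect to this basis. Assume that $\phi:B(H)\to B(H)$ is a bijective map such that for every pair $A,B\in B(H)$ the operator $A-B$ is invertible if and only if $\phi(A)-\phi(B)$ is invertible. Then there exist $R\in B(H)$ and invertible $T,S\in B(H)$ such that either $$\phi(A)=TAS+R\quad\text{for every }A\in B(H),$$ or $$\phi(A)=TA^tS+R\quad\text{for every }A\in B(H),$$ or $$\phi(A)=TA^*S+R\quad\text{for every }A\in B(H),$$ or $$\phi(A)=T(A^t)^*S+R\quad\text{for every }A\in B(H).$$
   Context: $A^*$ denotes the usual Hilbert space adjoint of $A$. For a fixed orthonormal basis $(e_i)_{i\in I}$ of $H$, the transpose $A^t$ of $A\in B(H)$ is the bounded linear operator whose matrix with respect to this basis is the transpose of the matrix of $A$, i.e. $\langle A^te_i,e_j\rangle=\langle Ae_j,e_i\rangle$ for all $i,j\in I$. An operator in $B(H)$ is invertible if it has an inverse in $B(H)$. The map $\phi$ is not assumed to be linear, additive or continuous. *)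

(* Defs.v *)
From HB Require Import structures.
From mathcomp Require Import all_boot all_order all_algebra.
From mathcomp Require Import sesquilinear complex.
From mathcomp Require Import all_classical all_reals all_analysis.

Set Implicit Arguments.
Unset Strict Implicit.
Unset Printing Implicit Defensive.

Import Order.TTheory GRing.Theory Num.Theory.
Import numFieldNormedType.Exports.

Local Open Scope classical_set_scope.
Local Open Scope complex_scope.
Local Open Scope ring_scope.

Definition is_bounded (R : realType) (H : normedModType R[i]) (f : H -> H) :=
  exists M : R, forall x, `|f x| <= M%:C * `|x|.

Record bounded_op (R : realType) (H : normedModType R[i]) := BoundedOp {
  bounded_op_lin :> {linear H -> H};
  bounded_opP : is_bounded bounded_op_lin }.

Notation "''B' ( H )" := (bounded_op H) (format "''B' ( H )") : type_scope.

HB.instance Definition _ (R : realType) (H : normedModType R[i]) :=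
  gen_eqMixin 'B(H).
HB.instance Definition _ (R : realType) (H : normedModType R[i]) :=
  gen_choiceMixin 'B(H).

Section BoundedOpRing.
Variables (R : realType) (H : normedModType R[i]).
Implicit Types (A B C : 'B(H)) (x : H).

Lemma bounded_op_ext A B : A =1 B -> A = B.
Proof.
move: A B => [[f [[Df] [Zf]]] bf] [[g [[Dg] [Zg]]] bg] /= /funext fg.
move: Df Zf bf Dg Zg bg; rewrite fg => Df Zf bf Dg Zg bg.
rewrite (Prop_irrelevance Df Dg) (Prop_irrelevance Zf Zg) in bf *.
by rewrite (Prop_irrelevance bf bg).
Qed.

Lemma op_bound A : exists2 M : R, 0 <= M & forall x, `|A x| <= M%:C * `|x|.
Proof.
case: (bounded_opP A) => M AM; exists `|M| => // x.
by rewrite (le_trans (AM x))// ler_wpM2r// lecR ler_norm.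
Qed.

Let id_bounded : is_bounded (@idfun H).
Proof. by exists 1 => x; rewrite mul1r. Qed.

Let zero_bounded : is_bounded (\0 : H -> H).
Proof. by exists 0 => x; rewrite mul0r normr0. Qed.

Let opp_bounded A : is_bounded (\- A).
Proof. by case: (op_bound A) => M _ AM; exists M => x; rewrite normrN. Qed.

Let add_bounded A B : is_bounded (A \+ B).
Proof.
case: (op_bound A) (op_bound B) => M _ AM [N _ BN]; exists (M + N) => x.
by rewrite rmorphD/= mulrDl (le_trans (ler_normD _ _))// lerD.
Qed.

Let comp_bounded A B : is_bounded (A \o B).
Proof.
case: (op_bound A) (op_bound B) => M M0 AM [N _ BN]; exists (M * N) => x /=.
by rewrite (le_trans (AM _))// rmorphM/= -mulrA ler_wpM2l// ler0c.
Qed.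

Definition zero_op : 'B(H) := BoundedOp zero_bounded.
Definition opp_op A : 'B(H) := BoundedOp (opp_bounded A).
Definition add_op A B : 'B(H) := BoundedOp (add_bounded A B).
Definition id_op : 'B(H) := BoundedOp id_bounded.
Definition comp_op A B : 'B(H) := BoundedOp (comp_bounded A B).

Let add_opA : associative add_op.
Proof. by move=> A B C; apply: bounded_op_ext => x /=; rewrite addrA. Qed.
Let add_opC : commutative add_op.
Proof. by move=> A B; apply: bounded_op_ext => x /=; rewrite addrC. Qed.
Let add_0op : left_id zero_op add_op.
Proof. by move=> A; apply: bounded_op_ext => x /=; rewrite add0r. Qed.
Let add_Nop : left_inverse zero_op opp_op add_op.
Proof. by move=> A; apply: bounded_op_ext => x /=; rewrite addNr. Qed.

HB.instance Definition _ :=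
  GRing.isZmodule.Build 'B(H) add_opA add_opC add_0op add_Nop.

Let comp_opA : associative comp_op.
Proof. by move=> A B C; apply: bounded_op_ext. Qed.
Let comp_1op : left_id id_op comp_op.
Proof. by move=> A; apply: bounded_op_ext. Qed.
Let comp_op1 : right_id id_op comp_op.
Proof. by move=> A; apply: bounded_op_ext. Qed.
Let comp_opDl : left_distributive comp_op +%R.
Proof. by move=> A B C; apply: bounded_op_ext. Qed.
Let comp_opDr : right_distributive comp_op +%R.
Proof. by move=> A B C; apply: bounded_op_ext => x /=; rewrite linearD. Qed.

HB.instance Definition _ := GRing.Zmodule_isPzRing.Build 'B(H)
  comp_opA comp_1op comp_op1 comp_opDl comp_opDr.

Lemma op0E x : (0 : 'B(H)) x = 0. Proof. by []. Qed.
Lemma op1E x : (1 : 'B(H)) x = x. Proof. by []. Qed.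
Lemma opNE A x : (- A) x = - A x. Proof. by []. Qed.
Lemma opDE A B x : (A + B) x = A x + B x. Proof. by []. Qed.
Lemma opBE A B x : (A - B) x = A x - B x. Proof. by []. Qed.
Lemma opME A B x : (A * B) x = A (B x). Proof. by []. Qed.

Definition op_invertible A := exists B, A * B = 1 /\ B * A = 1.

End BoundedOpRing.

Definition infinite_dimensional (F : fieldType) (V : lmodType F) :=
  forall (n : nat) (v : 'I_n -> V),
    exists x, forall c : 'I_n -> F, x <> \sum_i c i *: v i.

Section Hilbert.
Variables (R : realType) (H : completeNormedModType R[i]).
(* A dot product is linear in its first argument and antilinear in the second. *)
Variable dot : {dot H for (@Num.conj R[i])}.

(* With completeness of [H], this makes [(H, dot)] a Hilbert space. *)
Definition norm_from_dot := forall x : H, `|x| ^+ 2 = dot x x.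

Definition orthonormal_family (I : Type) (e : I -> H) :=
  (forall i, dot (e i) (e i) = 1) /\
  (forall i j, i <> j -> dot (e i) (e j) = 0).

Definition orthonormal_basis (I : Type) (e : I -> H) :=
  orthonormal_family e /\
  closure [set x | exists (s : seq I) (c : I -> R[i]),
                     x = \sum_(i <- s) c i *: e i] = setT.

(* The adjoint and the transpose are given as graphs: by the Riesz
   representation theorem every [A] has exactly one adjoint, and exactly one
   transpose with respect to an orthonormal basis [e]. *)
Definition is_adjoint (A B : 'B(H)) := forall x y, dot (A x) y = dot x (B y).

Definition is_transpose (I : Type) (e : I -> H) (A B : 'B(H)) :=
  forall i j, dot (B (e i)) (e j) = dot (A (e j)) (e i).

End Hilbert.

(* Main.v *)
Require Import Defs.
From HB Require Import structures.
From mathcomp Require Import all_boot all_order all_algebra.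
From mathcomp Require Import sesquilinear complex.
From mathcomp Require Import all_classical all_reals all_analysis.
From mathcomp Require Import ring lra.

Set Implicit Arguments.
Unset Strict Implicit.
Unset Printing Implicit Defensive.

Import Order.TTheory GRing.Theory Num.Theory.
Import numFieldNormedType.Exports.

Local Open Scope classical_set_scope.
Local Open Scope complex_scope.
Local Open Scope ring_scope.

(** After translating and multiplying by the inverse of [phi 1 - phi 0] we may
    assume [phi 0 = 0] and [phi 1 = 1].  Three operators lie on a common line of
    rank-one direction iff no operator [X] is such that [X - D] is invertible
    while [X - A] and [X - B] both are not; hence [phi] preserves such lines.
    On a set [{x (x) y | x}] invertibility also detects parallelism, so that,
    after composing with the adjoint if necessary,
    [phi (x (x) y) = T x (x) U y] where [T] is additive and semilinear for a
    field automorphism [tau] of the complex numbers.  For invertible [A],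
    [A - x (x) y] is singular iff [<A^-1 x, y> = 1]; comparing with the images
    gives [<T x, U y> = tau <x, y>] and [phi A \o T = T \o A].  Evaluating the
    first identity on [x = sum_n l_n e_n] shows, since [H] is
    infinite-dimensional, that [tau] is bounded near [0], hence is the identity
    or the conjugation; [T] is then bounded by a Hellinger-Toeplitz argument.
    Finally a map of this kind which fixes all invertible operators is the
    identity. *)

(** * Hilbert spaces *)

(** Nothing is known about images of sums or multiples, so linearity has to be extracted from
    incidence geometry: lines of rank-one direction, rows [{x (x) y | x}], columns [{x (x) y | y}],
    and parallelism inside a row. This yields only a semilinear [T], whose [tau] may a priori be a
    wild automorphism of the complex field. In finite dimension such an automorphism, applied to all
    matrix entries, does preserve invertibility; hence the continuity argument has to use infinitely
    many orthonormal vectors. The four forms come from two independent choices. Independent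
    operators of one row go either to a common row or to a common column, and the adjoint exchanges
    these cases. The automorphism is the identity or the conjugation, and the latter is absorbed by
    the antiunitary [J] fixing the basis: [J A J] is the adjoint of the transpose, and [J A^* J] is
    the transpose. Rank-one tests see an operator through its inverse, so they determine the map on
    invertible operators only; as it is not known to be additive, the other operators need an
    argument of their own. *)

Section HilbertBasics.
Variables (R : realType) (H : completeNormedModType R[i]).
Variable dot : {dot H for (@Num.conj R[i])}.
Hypothesis Hdot : norm_from_dot dot.
Implicit Types (x y z u v w : H) (a b c : R[i]) (A B : 'B(H)).

Lemma dotDl x y z : dot (x + y) z = dot x z + dot y z.
Proof. exact: (linearDl dot z x y). Qed.

Lemma dotDr x y z : dot x (y + z) = dot x y + dot x z.
Proof. exact: (linearDr dot x y z). Qed.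

Lemma dotZl a x y : dot (a *: x) y = a * dot x y.
Proof. exact: (linearZl_LR dot y a x). Qed.

Lemma dotZr a x y : dot x (a *: y) = Num.conj a * dot x y.
Proof. exact: (linearZr_LR dot x a y). Qed.

Lemma dot0l x : dot 0 x = 0.
Proof. exact: (linear0l dot x). Qed.

Lemma dot0r x : dot x 0 = 0.
Proof. exact: (linear0r dot x). Qed.

Lemma dotNl x y : dot (- x) y = - dot x y.
Proof. exact: (linearNl dot y x). Qed.

Lemma dotNr x y : dot x (- y) = - dot x y.
Proof. exact: (linearNr dot x y). Qed.

Lemma dotBl x y z : dot (x - y) z = dot x z - dot y z.
Proof. by rewrite dotDl dotNl. Qed.

Lemma dotBr x y z : dot x (y - z) = dot x y - dot x z.
Proof. by rewrite dotDr dotNr. Qed.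

Lemma dot_suml (J : Type) (r : seq J) (F : J -> H) y :
  dot (\sum_(i <- r) F i) y = \sum_(i <- r) dot (F i) y.
Proof. exact: (big_morph _ (fun x z => dotDl x z y) (dot0l y)). Qed.

Lemma dotC x y : dot x y = Num.conj (dot y x).
Proof. by rewrite (hermC dot x y) expr0 mul1r. Qed.

Lemma dotxx_eq0 x : (dot x x == 0) = (x == 0).
Proof. exact: (dnorm_eq0 dot x). Qed.

Lemma dot_eq0C x y : (dot x y == 0) = (dot y x == 0).
Proof. by rewrite dotC conjC_eq0. Qed.

Lemma dotl_ext x y : (forall z, dot x z = dot y z) -> x = y.
Proof.
move=> xy; apply/eqP; rewrite -subr_eq0 -dotxx_eq0 {1}dotBl xy.
by rewrite -dotBl subrr dot0l.
Qed.

Lemma dotr_ext x y : (forall z, dot z x = dot z y) -> x = y.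
Proof. by move=> xy; apply: dotl_ext => z; rewrite dotC xy -dotC. Qed.

(** Pythagoras for the component of [x] orthogonal to [y]. Its nonnegativity is the Cauchy-Schwarz
    inequality, and [Riesz] uses it to shorten a vector. *)
Lemma dot_residual x y : y != 0 ->
  dot (x - (dot x y / dot y y) *: y) (x - (dot x y / dot y y) *: y) =
  dot x x - `|dot x y| ^+ 2 / dot y y.
Proof.
move=> y0; have yy : dot y y != 0 by rewrite dotxx_eq0.
rewrite normCK -dotC !(dotBl, dotBr, dotZl, dotZr) rmorphM fmorphV /= -!dotC.
by field; exact: yy.
Qed.

Lemma CauchySchwarz x y : `|dot x y| <= `|x| * `|y|.
Proof.
have [->|y0] := eqVneq y 0; first by rewrite dot0r !normr0 mulr0.
rewrite -(@ler_pXn2r _ 2)// ?nnegrE ?mulr_ge0// exprMn !Hdot.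
have := dnorm_ge0 dot (x - (dot x y / dot y y) *: y).
by rewrite dot_residual// subr_ge0 ler_pdivrMr// lt_def dotxx_eq0 y0 dnorm_ge0.
Qed.

(** The norm takes values in [R[i]]; its real part is a number of [R], where [lra] and infima are
    available. [cn] does the same for scalars. *)
Definition nr x : R := complex.Re `|x|.

Lemma nrE x : `|x| = (nr x)%:C.
Proof.
have := normr_ge0 x; rewrite /nr; case: `|x| => a b /=.
by rewrite lecE/= => /andP[/eqP -> _].
Qed.

Lemma nr_ge0 x : 0 <= nr x.
Proof. by rewrite -ler0c -nrE. Qed.

Lemma nr0 : nr 0 = 0.
Proof. by rewrite /nr normr0. Qed.

Lemma nr_eq0 x : (nr x == 0) = (x == 0).
Proof. by rewrite -[RHS]normr_eq0 nrE (inj_eq (@complexI R)). Qed.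

Lemma nrD x y : nr (x + y) <= nr x + nr y.
Proof. by rewrite -lecR rmorphD /= -!nrE ler_normD. Qed.

Lemma nrN x : nr (- x) = nr x.
Proof. by rewrite /nr normrN. Qed.

Lemma nrB x y : nr (x - y) = nr (y - x).
Proof. by rewrite -nrN opprB. Qed.

Lemma nr_dist x y z : nr (x - z) <= nr (x - y) + nr (y - z).
Proof. by have := nrD (x - y) (y - z); rewrite addrA subrK. Qed.

Definition cn a : R := complex.Re `|a|.

Lemma cnE a : `|a| = (cn a)%:C.
Proof. by rewrite /cn normc_def. Qed.

Lemma cn_ge0 a : 0 <= cn a.
Proof. by rewrite -ler0c -cnE. Qed.

Lemma cnM a b : cn (a * b) = cn a * cn b.
Proof. by apply: complexI; rewrite rmorphM /= -!cnE normrM. Qed.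

Lemma cnD a b : cn (a + b) <= cn a + cn b.
Proof. by rewrite -lecR rmorphD /= -!cnE ler_normD. Qed.

Lemma cnN a : cn (- a) = cn a.
Proof. by rewrite /cn normrN. Qed.

Lemma cnV a : cn a^-1 = (cn a)^-1.
Proof. by apply: complexI; rewrite fmorphV /= -!cnE normfV. Qed.

Lemma cn_real (r : R) : cn r%:C = `|r|.
Proof. by rewrite /cn normc_def /= expr0n addr0 sqrtr_sqr. Qed.

Lemma cn_eq0 a : (cn a == 0) = (a == 0).
Proof. by rewrite -[RHS]normr_eq0 cnE (inj_eq (@complexI R)). Qed.

Lemma cnJ a : cn (Num.conj a) = cn a.
Proof. by rewrite /cn norm_conjC. Qed.

Lemma nrZ a x : nr (a *: x) = cn a * nr x.
Proof. by apply: complexI; rewrite rmorphM /= -nrE normrZ nrE cnE. Qed.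

Lemma cn_dot x y : cn (dot x y) <= nr x * nr y.
Proof. by rewrite -lecR rmorphM /= -!nrE -cnE CauchySchwarz. Qed.

Lemma dotxx x : dot x x = (nr x ^+ 2)%:C.
Proof. by rewrite -Hdot nrE rmorphXn. Qed.

Lemma parallelogram x y :
  nr (x + y) ^+ 2 + nr (x - y) ^+ 2 = 2 * nr x ^+ 2 + 2 * nr y ^+ 2.
Proof.
have : dot (x + y) (x + y) + dot (x - y) (x - y) = 2 * dot x x + 2 * dot y y.
  by rewrite !(dotDl, dotDr, dotNl, dotNr); ring.
rewrite !dotxx -(rmorph_nat (@real_complex R)) -!rmorphM -!rmorphD.
exact: complexI.
Qed.

Lemma complete_seq (u : nat -> H) :
  (forall e : R, 0 < e -> exists N, forall m n, (N <= m)%N -> (N <= n)%N ->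
     nr (u m - u n) < e) ->
  exists l, forall e : R, 0 < e -> exists N, forall n, (N <= n)%N ->
     nr (l - u n) < e.
Proof.
move=> uC; have /cauchy_cvgP/cvg_ex[l ul] : cauchy (u @ \oo).
  apply/cauchy_ballP => e e0.
  have eE : e = (complex.Re e)%:C.
    by move: e0; case: (e) => p q; rewrite ltcE/= => /andP[/eqP -> _].
  move: e0; rewrite eE ltcR => /uC[N uN].
  exists (u @` [set n | (N <= n)%N], u @` [set n | (N <= n)%N]).
    by split; exists N => // n /= Nn; exists n.
  move=> _ [[/= m Nm <-] [n Nn <-]].
  by rewrite -ball_normE /= nrE ltcR; exact: uN.
exists l => e e0; move/cvgrPdist_lt: ul => /(_ e%:C).
rewrite ltcR => /(_ e0)[N _ uN]; exists N => n /uN /=.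
by rewrite nrE ltcR.
Qed.

Lemma geometric_small (q e : R) : 0 <= q < 1 -> 0 < e ->
  exists N, forall n, (N <= n)%N -> q ^+ n < e.
Proof.
move=> /andP[q0 q1] e0.
have : (fun n => geometric 1 q n) @ \oo --> (0 : R).
  by apply: cvg_geometric; rewrite ger0_norm.
move/cvgrPdist_lt => /(_ _ e0)[N _ qN]; exists N => n Nn.
have := qN n Nn.
by rewrite /= sub0r normrN mul1r ger0_norm ?exprn_ge0.
Qed.

(** The later constructions need the explicit rate and not just convergence. *)
Lemma complete_geometric (u : nat -> H) (q : R) : 0 <= q < 1 ->
  (forall n, nr (u n.+1 - u n) <= q ^+ n) ->
  exists l, forall n, nr (l - u n) <= q ^+ n / (1 - q).
Proof.
move=> /andP[q0 q1] uq; have q1' : 0 < 1 - q by lra.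
have tail n k : nr (u (n + k)%N - u n) <= (q ^+ n - q ^+ (n + k)) / (1 - q).
  elim: k => [|k IH]; first by rewrite addn0 !subrr nr0 mul0r.
  rewrite (le_trans (nr_dist _ (u (n + k)%N) _))// addnS.
  rewrite (le_trans (lerD (uq _) IH))//.
  rewrite ler_pdivlMr// mulrDl divfK ?gt_eqF// exprS; lra.
have tail' n m : (n <= m)%N -> nr (u m - u n) <= q ^+ n / (1 - q).
  move=> nm; rewrite -(subnKC nm) (le_trans (tail _ _))// ler_pM2r ?invr_gt0//.
  by rewrite gerBl exprn_ge0.
have [|l ul] := @complete_seq u.
  move=> e e0; have e1 : 0 < e * (1 - q) / 2 by rewrite divr_gt0// mulr_gt0.
  have [|N qN] := @geometric_small q _ _ e1; first by rewrite q0.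
  exists N => m n Nm Nn; have qNe := qN N (leqnn N).
  rewrite (le_lt_trans (nr_dist _ (u N) _))// (nrB (u N)).
  have : q ^+ N / (1 - q) < e / 2 by rewrite ltr_pdivrMr//; lra.
  by have := tail' _ _ Nm; have := tail' _ _ Nn; lra.
exists l => n; apply/ler_addgt0Pr => e e0.
have [N uN] := ul _ e0; have := uN (maxn n N) (leq_maxr _ _).
have := tail' n (maxn n N) (leq_maxl _ _).
by have := nr_dist l (u (maxn n N)) (u n); lra.
Qed.

(** The vector of least norm in the hyperplane [f = 1] is orthogonal to the kernel of [f], hence
    represents [f] after rescaling. *)
Lemma Riesz (f : {linear H -> R[i] | *%R}) (M : R) :
  (forall x, cn (f x) <= M * nr x) -> exists w, forall x, f x = dot x w.
Proof.
move=> fM; have [[z fz]|f0] := pselect (exists z, f z != 0); last first.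
  exists 0 => x; rewrite dot0r; apply/eqP/negPn/negP => fx.
  by apply: f0; exists x.
pose S : set R := [set nr u | u in [set u | f u = 1]].
have S0 : has_inf S.
  split; last by exists 0 => _ [u _ <-]; exact: nr_ge0.
  by exists (nr ((f z)^-1 *: z)), ((f z)^-1 *: z) => //=;
    rewrite linearZ/= mulVf.
pose d := inf S.
have d0 : 0 <= d by apply: lb_le_inf; [case: S0|move=> _ [u _ <-]; exact: nr_ge0].
have Sd u : f u = 1 -> d <= nr u.
  by move=> fu; apply: (ge_inf (proj2 S0)); exists u.
have /choice[u uS] n : exists u, f u = 1 /\ nr u ^+ 2 <= d ^+ 2 + n.+1%:R^-1.
  pose t := Num.sqrt (d ^+ 2 + n.+1%:R^-1) - d.
  have t0 : 0 < t.
    rewrite subr_gt0 -(@ltr_pXn2r _ 2) ?nnegrE ?sqrtr_ge0// sqr_sqrtr.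
      by rewrite ltrDl invr_gt0.
    by rewrite addr_ge0 ?sqr_ge0 ?invr_ge0.
  have [_ [u fu <-] ud] := inf_adherent t0 S0; exists u; split=> //.
  rewrite -/d /t addrC subrK in ud.
  rewrite -[leRHS]sqr_sqrtr; last by rewrite addr_ge0 ?sqr_ge0// invr_ge0.
  by rewrite ler_pXn2r ?nnegrE ?sqrtr_ge0 ?nr_ge0// ltW.
(* The midpoint of [u1] and [u2] also satisfies [f = 1], so its norm is at least [d]; the
   parallelogram law then bounds the distance. *)
have near u1 u2 (s t : R) : f u1 = 1 -> f u2 = 1 ->
    nr u1 ^+ 2 <= d ^+ 2 + s -> nr u2 ^+ 2 <= d ^+ 2 + t ->
    nr (u1 - u2) ^+ 2 <= 2 * s + 2 * t.
  move=> f1 f2 s1 s2; have := parallelogram u1 u2.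
  have : d <= nr (2^-1 *: (u1 + u2)).
    by apply: Sd; rewrite linearZ linearD /= f1 f2 mulVf.
  rewrite nrZ cnV -(rmorph_nat (@real_complex R)) cn_real normr_nat.
  rewrite ler_pdivlMl// => d2.
  have : (2 * d) ^+ 2 <= nr (u1 + u2) ^+ 2.
    by rewrite ler_pXn2r ?nnegrE ?nr_ge0// mulr_ge0.
  rewrite exprMn; lra.
have [|l ul] := @complete_seq u.
  move=> e e0; pose N := (Num.truncn (4 / e ^+ 2)).+1.
  have Ne : 4 / N%:R < e ^+ 2.
    rewrite ltr_pdivrMr// mulrC -ltr_pdivrMr ?exprn_gt0//.
    by rewrite (lt_le_trans (truncnS_gt _)).
  exists N => m n Nm Nn.
  have [[fm um] [fn un]] := (uS m, uS n).
  have := near _ _ _ _ fm fn um un.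
  have inv k : (N <= k)%N -> (k.+1%:R^-1 : R) <= N%:R^-1.
    by move=> Nk; rewrite lef_pV2 ?posrE// ler_nat leqW.
  rewrite -(@ltr_pXn2r _ 2) ?nnegrE ?nr_ge0 ?(ltW e0)//.
  move: (inv _ Nm) (inv _ Nn) Ne.
  move: (N%:R^-1 : R) (m.+1%:R^-1 : R) => p q.
  by move: (n.+1%:R^-1 : R) (e ^+ 2) (nr _ ^+ 2) => r s t; lra.
have fl : f l = 1.
  apply/eqP; rewrite -subr_eq0 -cn_eq0 eq_le cn_ge0 andbT.
  apply/ler_addgt0Pr => e e0; rewrite add0r.
  have M1 : 0 < `|M| + 1 by rewrite ltr_wpDl.
  have [N uN] := ul (e / (`|M| + 1)) (divr_gt0 e0 M1).
  have [fN _] := uS N; have := uN _ (leqnn N).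
  rewrite -fN -linearB => lu; rewrite (le_trans (fM _))//.
  rewrite ltr_pdivlMr// mulrC in lu; rewrite (le_trans _ (ltW lu))//.
  by rewrite ler_wpM2r ?nr_ge0// ler_wpDr// ler_norm.
have ld : nr l <= d.
  apply/ler_addgt0Pr => e e0; have e2 : 0 < e / 2 by rewrite divr_gt0.
  have [N uN] := ul _ e2.
  pose n := maxn N (Num.truncn ((e / 2) ^+ 2)^-1).+1.
  have [_ un] := uS n; have := uN n (leq_maxl _ _).
  have ne : n.+1%:R^-1 <= (e / 2) ^+ 2.
    rewrite -[leRHS]invrK lef_pV2 ?posrE ?invr_gt0 ?exprn_gt0//.
    rewrite (le_trans (ltW (truncnS_gt _)))// ler_nat leqW// leq_maxr//.
  have : nr (u n) <= d + e / 2.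
    rewrite -(@ler_pXn2r _ 2) ?nnegrE ?nr_ge0 ?addr_ge0// ?(ltW e2)//.
    rewrite (le_trans un)// sqrrD -addrA lerD2l.
    by rewrite (le_trans ne)// lerDr mulrn_wge0// mulr_ge0// ltW.
  by have := nrD (l - u n) (u n); rewrite subrK; lra.
(* Subtracting from [l] its projection on [z'] keeps [f = 1], so minimality forces the projection to
   vanish. *)
have orth z' : f z' = 0 -> dot z' l = 0.
  move=> fz'; have [->|z'0] := eqVneq z' 0; first by rewrite dot0l.
  pose t := dot l z' / dot z' z'.
  have zz : dot z' z' != 0 by rewrite dotxx_eq0.
  have := Sd (l - t *: z'); rewrite linearB linearZ /= fz' mulr0 subr0.
  move=> /(_ fl) /(le_trans ld).
  rewrite -(@ler_pXn2r _ 2) ?nnegrE ?nr_ge0// -lecR -!dotxx.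
  rewrite dot_residual// lerBrDl gerDr.
  rewrite pmulr_lle0 ?invr_gt0; last by rewrite lt_def zz dnorm_ge0.
  move=> le0; apply/eqP; rewrite dot_eq0C -normr_eq0 -sqrf_eq0 eq_le le0.
  by rewrite exprn_ge0.
have ll : dot l l != 0.
  rewrite dotxx_eq0; apply/eqP => l0; move: fl.
  by rewrite l0 linear0 => /esym/eqP; rewrite oner_eq0.
exists ((Num.conj (dot l l))^-1 *: l) => x.
have fx0 : f (x - f x *: l) = 0 by rewrite linearB linearZ /= fl mulr1 subrr.
have /eqP := orth _ fx0; rewrite dotBl dotZl subr_eq0 => /eqP xl.
by rewrite dotZr fmorphV /= conjCK xl mulrC mulfK.
Qed.

End HilbertBasics.

(** * Adjoints and rank-one operators *)

Section RankOne.
Variables (R : realType) (H : completeNormedModType R[i]).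
Variable dot : {dot H for (@Num.conj R[i])}.
Hypothesis Hdot : norm_from_dot dot.
Implicit Types (x y z u v w p q : H) (a b c : R[i]) (A B X Y Z : 'B(H)).

Lemma mk_op (f : H -> H) (M : R) : linear f ->
  (forall x, nr (f x) <= M * nr x) -> exists A : 'B(H), forall x, A x = f x.
Proof.
move=> lf fM.
pose g : {linear H -> H} := HB.pack f (GRing.isLinear.Build _ _ _ _ _ lf).
suff bg : is_bounded g by exists (BoundedOp bg).
by exists M => x; rewrite !nrE -rmorphM lecR fM.
Qed.

Lemma op_nr_bound A : exists2 M : R, 0 <= M & forall x, nr (A x) <= M * nr x.
Proof.
have [M M0 AM] := op_bound A; exists M => // x.
by rewrite -lecR rmorphM /= -!nrE; exact: AM.
Qed.

Lemma adjoint_exists A : exists B, is_adjoint dot A B.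
Proof.
have [M M0 AM] := op_nr_bound A.
have /choice[f fE] y : exists w, forall x, dot (A x) y = dot x w.
  have lf : linear_for *%R (fun x => dot (A x) y).
    by move=> a x z; rewrite linearP dotDl dotZl.
  pose g : {linear H -> R[i] | *%R} :=
    HB.pack (fun x => dot (A x) y) (GRing.isLinear.Build _ _ _ _ _ lf).
  apply: (@Riesz _ _ _ Hdot g (M * nr y)) => x.
  by rewrite (le_trans (cn_dot Hdot _ _))// mulrAC ler_wpM2r ?nr_ge0.
have [||B BE] := @mk_op f M; last by exists B => x y; rewrite BE fE.
- move=> a x y; apply: (@dotr_ext _ _ dot) => z.
  by rewrite -fE !(dotDr, dotZr) !fE.
- move=> y; have [->|fy] := eqVneq (f y) 0.
    by rewrite nr0 mulr_ge0 ?nr_ge0.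
  have fy0 : 0 < nr (f y) by rewrite lt_def nr_eq0 fy nr_ge0.
  rewrite -(ler_pM2l fy0) -expr2 -[leLHS]ger0_norm ?sqr_ge0// -cn_real.
  rewrite -(dotxx Hdot) -fE (le_trans (cn_dot Hdot _ _))// mulrA.
  by rewrite ler_wpM2r ?nr_ge0// mulrC AM.
Qed.

Definition adj A : 'B(H) := sval (cid (adjoint_exists A)).

Lemma adjP A : is_adjoint dot A (adj A).
Proof. exact: (svalP (cid (adjoint_exists A))). Qed.

Lemma dot_adj A x y : dot (A x) y = dot x (adj A y).
Proof. exact: adjP. Qed.

Lemma adj_dot A x y : dot (adj A x) y = dot x (A y).
Proof. by rewrite dotC -dot_adj -dotC. Qed.

Lemma adj_uniq A B : is_adjoint dot A B -> adj A = B.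
Proof.
move=> AB; apply: bounded_op_ext => y; apply: (@dotr_ext _ _ dot) => z.
by rewrite -dot_adj AB.
Qed.

Lemma adjK A : adj (adj A) = A.
Proof. by apply: adj_uniq => x y; rewrite adj_dot. Qed.

Lemma adjB A B : adj (A - B) = adj A - adj B.
Proof. by apply: adj_uniq => x y; rewrite !opBE dotBl dotBr !dot_adj. Qed.

Lemma adjM A B : adj (A * B) = adj B * adj A.
Proof. by apply: adj_uniq => x y; rewrite !opME !dot_adj. Qed.

Lemma adj1 : adj 1 = 1.
Proof. by apply: adj_uniq. Qed.

Lemma adj0 : adj 0 = 0.
Proof. by apply: adj_uniq => x y; rewrite !op0E dot0l dot0r. Qed.

Lemma inv_adj A : op_invertible A -> op_invertible (adj A).
Proof. by move=> [B [AB BA]]; exists (adj B); rewrite -!adjM AB BA adj1. Qed.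

Lemma inv_adjE A : op_invertible (adj A) <-> op_invertible A.
Proof. by split=> [/inv_adj|/inv_adj//]; rewrite adjK. Qed.

Lemma rk1_exists x y : exists A : 'B(H), forall z, A z = dot z y *: x.
Proof.
apply: (@mk_op _ (nr y * nr x)) => [a z t|z].
  by rewrite dotDl dotZl scalerDl scalerA.
rewrite nrZ mulrAC (mulrC (nr y)) ler_wpM2r ?nr_ge0//; exact: cn_dot.
Qed.

(* The operator usually written [x (x) y]. *)
Definition rk1 x y : 'B(H) := sval (cid (rk1_exists x y)).

Lemma rk1E x y z : rk1 x y z = dot z y *: x.
Proof. exact: (svalP (cid (rk1_exists x y))). Qed.

Lemma rk1Dl x1 x2 y : rk1 (x1 + x2) y = rk1 x1 y + rk1 x2 y.
Proof. by apply: bounded_op_ext => z; rewrite opDE !rk1E scalerDr. Qed.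

Lemma rk1Nl x y : rk1 (- x) y = - rk1 x y.
Proof. by apply: bounded_op_ext => z; rewrite opNE !rk1E scalerN. Qed.

Lemma rk1Dr x y1 y2 : rk1 x (y1 + y2) = rk1 x y1 + rk1 x y2.
Proof. by apply: bounded_op_ext => z; rewrite opDE !rk1E dotDr scalerDl. Qed.

Lemma rk1Nr x y : rk1 x (- y) = - rk1 x y.
Proof. by apply: bounded_op_ext => z; rewrite opNE !rk1E dotNr scaleNr. Qed.

Lemma rk1Zr c x y : rk1 x (c *: y) = rk1 (Num.conj c *: x) y.
Proof.
by apply: bounded_op_ext => z; rewrite !rk1E dotZr scalerA mulrC.
Qed.

Lemma rk1_0l y : rk1 0 y = 0.
Proof. by apply: bounded_op_ext => z; rewrite rk1E scaler0. Qed.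

Lemma rk1_0r x : rk1 x 0 = 0.
Proof. by apply: bounded_op_ext => z; rewrite rk1E dot0r scale0r. Qed.

Lemma rk1_eq0 x y : rk1 x y = 0 -> x = 0 \/ y = 0.
Proof.
have [->|y0] := eqVneq y 0; first by right.
move=> /(congr1 (fun A : 'B(H) => A y)); rewrite rk1E op0E => /eqP.
by rewrite scaler_eq0 dotxx_eq0 (negbTE y0)/= => /eqP; left.
Qed.

Lemma rk1_neq0 x y : x != 0 -> y != 0 -> rk1 x y <> 0.
Proof. by move=> x0 y0 /rk1_eq0[]/eqP; apply/negP. Qed.

Lemma adj_rk1 x y : adj (rk1 x y) = rk1 y x.
Proof.
by apply: adj_uniq => z t; rewrite !rk1E dotZl dotZr mulrC -dotC.
Qed.

Lemma rk1_injl y x1 x2 : y != 0 -> rk1 x1 y = rk1 x2 y -> x1 = x2.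
Proof.
move=> y0 /(congr1 (fun A : 'B(H) => A y)); rewrite !rk1E.
by apply: scalerI; rewrite dotxx_eq0.
Qed.

Lemma rk1_injr x y1 y2 : x != 0 -> rk1 x y1 = rk1 x y2 -> y1 = y2.
Proof.
move=> x0 xy; apply: (@dotr_ext _ _ dot) => z; move: xy.
move=> /(congr1 (fun A : 'B(H) => A z)); rewrite !rk1E => /eqP.
by rewrite -subr_eq0 -scalerBl scaler_eq0 (negbTE x0) orbF subr_eq0 => /eqP.
Qed.

(** Asymmetric at zero: [par x 0] always holds, [par 0 y] only for [y = 0]. *)
Definition par x y := exists c, y = c *: x.
Definition indep x y := x != 0 /\ ~ par x y.

Lemma par0 x : par x 0.
Proof. by exists 0; rewrite scale0r. Qed.

Lemma parxx x : par x x.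
Proof. by exists 1; rewrite scale1r. Qed.

Lemma parD x y z : par x y -> par x z -> par x (y + z).
Proof. by move=> [a ->] [b ->]; exists (a + b); rewrite scalerDl. Qed.

Lemma parB x y z : par x y -> par x z -> par x (y - z).
Proof. by move=> [a ->] [b ->]; exists (a - b); rewrite scalerBl. Qed.

Lemma parZ c x y : par x y -> par x (c *: y).
Proof. by move=> [a ->]; exists (c * a); rewrite scalerA. Qed.

Lemma par_trans x y z : par x y -> par y z -> par x z.
Proof. by move=> [a ->] [b ->]; exists (b * a); rewrite scalerA. Qed.

Lemma par_sym x y : y != 0 -> par x y -> par y x.
Proof.
move=> y0 [c yc]; exists c^-1; rewrite yc scalerA mulVf ?scale1r//.
by apply: contra y0 => /eqP c0; rewrite yc c0 scale0r.
Qed.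

Lemma indep_neq0r x y : indep x y -> y != 0.
Proof. by move=> [_ xy]; apply/eqP => y0; apply: xy; rewrite y0;
  exact: par0. Qed.

Lemma indep_sym x y : indep x y -> indep y x.
Proof.
move=> xy; have y0 := indep_neq0r xy; case: xy => x0 xy; split=> // yx.
by apply: xy; apply: par_sym.
Qed.

Lemma indep_coef x y a b : indep x y -> a *: x + b *: y = 0 -> a = 0 /\ b = 0.
Proof.
move=> [x0 xy] /eqP; rewrite addr_eq0 => /eqP ab.
have b0 : b = 0.
  apply/eqP/negPn/negP => b0; apply: xy; exists (- (b^-1 * a)).
  by rewrite scaleNr -scalerA ab scalerN opprK scalerA mulVf// scale1r.
split=> //; move/eqP: ab; rewrite b0 scale0r oppr0 scaler_eq0 (negbTE x0) orbF.
by move=> /eqP.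
Qed.

Lemma indep_coef2 x y a b a' b' : indep x y ->
  a *: x + b *: y = a' *: x + b' *: y -> a = a' /\ b = b'.
Proof.
move=> xy /eqP; rewrite -subr_eq0 opprD addrACA -!scalerBl => /eqP.
by move=> /(indep_coef xy)[/eqP + /eqP]; rewrite !subr_eq0 => /eqP -> /eqP ->.
Qed.

(** The component of [z] orthogonal to [x]; for [x = 0] the division by zero makes it [z], which is
    the right value. *)
Definition resid x z := z - (dot z x / dot x x) *: x.

Lemma dot_resid x z : dot (resid x z) x = 0.
Proof.
have [->|x0] := eqVneq x 0; first by rewrite dot0r.
by rewrite dotBl dotZl divfK ?subrr// dotxx_eq0.
Qed.

Lemma dot_resid_sym x z w : dot (resid x z) w = dot z (resid x w).
Proof.
rewrite dotBl dotBr dotZl dotZr rmorphM fmorphV /= -!dotC; congr (_ - _).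
by rewrite mulrAC [RHS]mulrAC; congr (_ / _); exact: mulrC.
Qed.

Lemma dot_resid_self x z : dot z (resid x z) = dot (resid x z) (resid x z).
Proof.
rewrite {2}/resid [in RHS]dotBl dotZl (dotC dot x (resid x z)) dot_resid.
by rewrite rmorph0 mulr0 subr0.
Qed.

Lemma par_resid x z : resid x z = 0 -> par x z.
Proof. by move=> /eqP; rewrite subr_eq0 => /eqP ->;
  exists (dot z x / dot x x). Qed.

Lemma separate x z : ~ par x z -> exists t, dot t x = 0 /\ dot t z != 0.
Proof.
move=> xz; exists (resid x z); split; first exact: dot_resid.
rewrite dot_eq0C dot_resid_self dotxx_eq0.
by apply/eqP => /par_resid.
Qed.

Lemma par_of_ortho x z : (forall t, dot t x = 0 -> dot t z = 0) -> par x z.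
Proof.
move=> xz; have [//|/separate[t [tx tz]]] := pselect (par x z).
by move: tz; rewrite xz// eqxx.
Qed.

Lemma rank1P A x : x != 0 -> (forall z, par x (A z)) -> exists y, A = rk1 x y.
Proof.
move=> x0 xA; exists ((Num.conj (dot x x))^-1 *: adj A x).
apply: bounded_op_ext => z; rewrite rk1E dotZr -dot_adj fmorphV /= conjCK.
have [c ->] := xA z.
by rewrite dotZl mulrC mulfK// dotxx_eq0.
Qed.

(** Two operators of rank one that differ by rank one share a column or a row. Unless [v] is
    parallel to [y], a vector orthogonal to [y] but not to [v] shows [u] to be a multiple of [p],
    and one orthogonal to [v] but not to [y] does so for [x]. *)
Lemma sum_rk1 x y u v p q : x != 0 -> y != 0 -> 
  rk1 u v = rk1 x y + rk1 p q -> par x u \/ par y v.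
Proof.
move=> x0 y0 E; have {}E z : dot z v *: u = dot z y *: x + dot z q *: p.
  by rewrite -!rk1E E opDE.
have [|yv] := pselect (par y v); first by right.
left; have [t [ty tv]] := separate yv.
have vy : ~ par v y by move=> /(par_sym y0).
have [s [sv sy]] := separate vy.
have := E t; rewrite ty scale0r add0r => Et.
have := E s; rewrite sv scale0r => /eqP; rewrite eq_sym addr_eq0 => /eqP Es.
have px : par p x.
  exists (- ((dot s y)^-1 * dot s q)).
  by rewrite scaleNr -scalerA -scalerN -Es scalerA mulVf// scale1r.
have pu : par p u.
  by exists ((dot t v)^-1 * dot t q);
    rewrite -scalerA -Et scalerA mulVf// scale1r.
exact: par_trans (par_sym x0 px) pu.
Qed.

Lemma inv_inj A x : op_invertible A -> A x = 0 -> x = 0.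
Proof. by move=> [B [_ BA]] Ax; rewrite -(Defs.op1E x) -BA opME Ax linear0. Qed.

End RankOne.

(** * Lines of rank-one direction *)

Section Collinear.
Variables (R : realType) (H : completeNormedModType R[i]).
Variable dot : {dot H for (@Num.conj R[i])}.
Hypothesis Hdot : norm_from_dot dot.
Hypothesis dim2 : forall x : H, exists y, ~ par x y.
Implicit Types (x y z u v w p q : H) (a b c : R[i]) (A B D W X Y Z : 'B(H)).
Local Notation rk1 := (rk1 Hdot).

Lemma inv1 : op_invertible (1 : 'B(H)).
Proof. by exists 1; rewrite mulr1. Qed.

Lemma invM A B : op_invertible A -> op_invertible B -> op_invertible (A * B).
Proof.
move=> [A' [AA' A'A]] [B' [BB' B'B]]; exists (B' * A'); split.
  by rewrite mulrA -(mulrA A) BB' mulr1.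
by rewrite mulrA -(mulrA B') A'A mulr1.
Qed.

Lemma invN A : op_invertible A -> op_invertible (- A).
Proof. by move=> [B [AB BA]]; exists (- B); rewrite !mulrNN. Qed.

Lemma inv_subC A B : op_invertible (A - B) <-> op_invertible (B - A).
Proof. by split=> /invN; rewrite opprB. Qed.

Lemma invMl A B W : A * W = 1 -> W * A = 1 ->
  op_invertible (A * B) <-> op_invertible B.
Proof.
move=> AW WA; split=> [AB|]; last by apply: invM; exists W.
rewrite -[B]mul1r -WA -mulrA; apply: invM => //.
by exists A.
Qed.

(** The Sherman-Morrison formula; when [dot x y = 1], the vector [x] lies in the kernel. *)
Lemma inv_1_sub_rk1 x y : op_invertible (1 - rk1 x y) <-> dot x y <> 1.
Proof.
split=> [inv xy|/eqP xy].
  have x0 : x = 0 by apply: (inv_inj inv);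
    rewrite opBE Defs.op1E rk1E xy scale1r subrr.
  by move: xy; rewrite x0 dot0l => /eqP; rewrite eq_sym oner_eq0.
have xy1 : 1 - dot x y != 0 by rewrite subr_eq0 eq_sym.
pose k := (1 - dot x y)^-1.
have kE : k * (1 - dot x y) = 1 by rewrite mulVf.
have scal0 z e : e = 0 -> z + e *: x = z by move=> ->; rewrite scale0r addr0.
exists (1 + rk1 (k *: x) y); split; apply: bounded_op_ext => z.
  rewrite opME opBE opDE !Defs.op1E !rk1E scalerA dotDl dotZl -addrA -scaleNr.
  rewrite -scalerDl; apply: scal0.
  have -> : dot z y * k - (dot z y + dot z y * k * dot x y) =
    dot z y * (k * (1 - dot x y) - 1) by ring.
  by rewrite kE subrr mulr0.
rewrite opME opDE opBE !Defs.op1E !rk1E scalerA dotBl dotZl -addrA -scaleNr.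
rewrite -scalerDl; apply: scal0.
have -> : - dot z y + (dot z y - dot z y * dot x y) * k =
  dot z y * (k * (1 - dot x y) - 1) by ring.
by rewrite kE subrr mulr0.
Qed.

Lemma mul_rk1 A x y : A * rk1 x y = rk1 (A x) y.
Proof. by apply: bounded_op_ext => z; rewrite opME !rk1E linearZ. Qed.

(** The dictionary used throughout: with [W] the inverse of [A], a rank-one test of invertibility
    becomes a scalar equation. *)
Lemma inv_sub_rk1 A W x y : A * W = 1 -> W * A = 1 ->
  op_invertible (A - rk1 x y) <-> dot (W x) y <> 1.
Proof.
move=> AW WA; rewrite -inv_1_sub_rk1 -mul_rk1 -(invMl _ WA AW).
by rewrite mulrBr WA.
Qed.

Lemma separate_scaled p q : p != 0 -> q != 0 ->
  exists f, dot p f = 1 /\ dot q f != 0.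
Proof.
move=> p0 q0; suff [g [pg qg]] : exists g, dot p g != 0 /\ dot q g != 0.
  exists ((Num.conj (dot p g))^-1 *: g).
  rewrite !dotZr fmorphV /= conjCK mulVf//; split => //.
  by rewrite mulf_neq0// invr_neq0.
have [qp|qp] := eqVneq (dot q p) 0; last by exists p; rewrite dotxx_eq0.
exists (p + q); rewrite !dotDr qp add0r dotxx_eq0; split => //.
by have /eqP := qp; rewrite dot_eq0C => /eqP ->; rewrite addr0 dotxx_eq0.
Qed.

Lemma one_sub_neq1 c : c != 0 -> 1 - c <> 1.
Proof.
by move=> /negbTE c0 /eqP; rewrite subr_eq -subr_eq0 opprD addrA subrr sub0r
  oppr_eq0 c0.
Qed.

Lemma transitive1 p q : p != 0 -> q != 0 ->
  exists Z, op_invertible Z /\ Z p = q.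
Proof.
move=> p0 q0; have [f [pf qf]] := separate_scaled p0 q0.
exists (1 - rk1 (p - q) f); split; last first.
  by rewrite opBE Defs.op1E rk1E pf scale1r opprB addrC subrK.
by rewrite inv_1_sub_rk1 dotBl pf; exact: one_sub_neq1.
Qed.

(** [Z1] moves the first vector; the second is corrected by a rank-one perturbation whose functional
    [g] vanishes on [u]. Projecting away from [u] is self-adjoint, so the conditions on [g] become
    conditions on the residuals of [Z1 q] and [v]. *)
Lemma transitive2 p q u v : indep p q -> indep u v ->
  exists Z, [/\ op_invertible Z, Z p = u & Z q = v].
Proof.
move=> pq uv; have [Z1 [Z1i Zp]] := transitive1 (proj1 pq) (proj1 uv).
have resid0 w : ~ par u w -> resid dot u w != 0.
  by move=> uw; apply/eqP => /par_resid.
have uq : ~ par u (Z1 q).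
  move=> [c]; rewrite -Zp -linearZ => /eqP; rewrite -subr_eq0 -linearB => /eqP.
  move=> /(inv_inj Z1i) /eqP; rewrite subr_eq0 => /eqP qp.
  by case: pq => _; apply; exists c.
have [f [qf vf]] := separate_scaled (resid0 _ uq) (resid0 _ (proj2 uv)).
pose g := resid dot u f.
have ug : dot u g = 0 by apply/eqP; rewrite dot_eq0C dot_resid.
have qg : dot (Z1 q) g = 1 by rewrite -dot_resid_sym.
have vg : dot v g != 0 by rewrite -dot_resid_sym.
exists ((1 - rk1 (Z1 q - v) g) * Z1); split.
- apply: invM => //; rewrite inv_1_sub_rk1 dotBl qg; exact: one_sub_neq1.
- by rewrite opME opBE Defs.op1E rk1E Zp ug scale0r subr0.
- by rewrite opME opBE Defs.op1E rk1E qg scale1r opprB addrC subrK.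
Qed.

(* Collinearity of three operators on a line of rank-one direction, expressed
   through invertibility of differences only. *)
Definition coll A B D := [/\ A <> B, D <> A, D <> B &
  forall X, op_invertible (X - D) ->
    op_invertible (X - A) \/ op_invertible (X - B)].

(** With [Y = X - D] and [m = dot (Y^-1 x) y], the other two differences are singular iff
    [- c * m = 1], respectively [(1 - c) * m = 1]; together these would give [m = 0], which
    contradicts the first. *)
Lemma coll_rk1 A x y c : x != 0 -> y != 0 -> c != 0 -> c != 1 ->
  coll A (A + rk1 x y) (A + rk1 (c *: x) y).
Proof.
move=> x0 y0 c0 c1.
have rk0 d : d != 0 -> rk1 (d *: x) y <> 0.
  by move=> d0; apply: rk1_neq0; rewrite ?scaler_eq0 ?negb_or ?d0.
split.
- move=> /eqP; rewrite eq_sym -subr_eq0 addrC addKr => /eqP.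
  by apply: rk1_neq0.
- by move=> /eqP; rewrite -subr_eq0 addrC addKr => /eqP; apply: rk0.
- move=> /addrI /eqP; rewrite -subr_eq0 -rk1Nl -rk1Dl.
  rewrite -[in - x](scale1r x) -scalerBl => /eqP; apply: rk0.
  by rewrite subr_eq0.
move=> X [W [YW WY]]; set Y := X - (A + rk1 (c *: x) y) in YW WY.
have XA : X - A = Y - rk1 ((- c) *: x) y.
  by rewrite /Y scaleNr rk1Nl opprK opprD addrA subrK.
have XB : X - (A + rk1 x y) = Y - rk1 ((1 - c) *: x) y.
  by rewrite /Y scalerBl scale1r rk1Dl rk1Nl opprB !opprD !addrA subrK.
rewrite XA XB !(inv_sub_rk1 _ _ YW WY) !linearZ !dotZl.
have [Wc|//] := pselect ((- c) * dot (W x) y = 1); last by left.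
right; rewrite mulrBl mul1r -mulNr Wc => /eqP.
rewrite -subr_eq0 addrK => /eqP Wx; move: Wc => /eqP.
by rewrite Wx mulr0 eq_sym oner_eq0.
Qed.

(* If [p], [q] and [A p], [B q] were both independent pairs, an invertible [Z]
   with [Z (A p) = p] and [Z (B q) = q] would make both [Z^-1 - A] and
   [Z^-1 - B] singular. *)
Lemma indep_pair_pres A B :
  (forall W, op_invertible W -> op_invertible (W - A) \/ op_invertible (W - B)) ->
  forall p q, indep p q -> ~ indep (A p) (B q).
Proof.
move=> AB p q pq ApBq; have [Z [[W [ZW WZ]] Zp Zq]] := transitive2 ApBq pq.
have sing D r : r != 0 -> Z (D r) = r -> ~ op_invertible (W - D).
  move=> r0 ZD WDi; move: r0; suff -> : r = 0 by rewrite eqxx.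
  apply: (inv_inj WDi).
  have : (W * Z) (D r) = D r by rewrite WZ.
  by rewrite opME ZD opBE => ->; rewrite subrr.
have [|/(sing _ _ (proj1 pq) Zp)//|] := AB W; first by exists Z.
exact: (sing _ _ (indep_neq0r pq) Zq).
Qed.

(** Immediate for [q] off the line of [p]; on it, [B q = B (q + r) - B r] with [r] off the line. *)
Lemma par_image A B p : A p != 0 -> 
  (forall p q, indep p q -> ~ indep (A p) (B q)) ->
  forall q, par (A p) (B q).
Proof.
move=> Ap AB q; have p0 : p != 0.
  by apply: contra Ap => /eqP ->; rewrite linear0.
have parAB r : ~ par p r -> par (A p) (B r).
  by move=> pr; apply: contrapT => ABr; apply: (AB p r).
have [pq|] := pselect (par p q); last exact: parAB.
have [r pr] := dim2 p.
rewrite -(addrK r q) linearB; apply: parB; apply: parAB => //.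
by move=> /parB /(_ pq); rewrite addrC addKr.
Qed.

(** Relative to [D], the operators [A] and [B] have their ranges in one common line, so they become
    [rk1 x y1] and [rk1 x y2]; what remains is that [y1] is parallel to [y2 - y1]. *)
Lemma coll_inv A B D : coll A B D -> exists x y c,
  [/\ x != 0, y != 0, (c != 0) && (c != 1), B = A + rk1 x y &
      D = A + rk1 (c *: x) y].
Proof.
move=> [AB DA DB ABD].
have inv' W : op_invertible W ->
    op_invertible (W - (A - D)) \/ op_invertible (W - (B - D)).
  by move=> Wi; rewrite !opprB !addrA; apply: ABD; rewrite addrK.
have nz E : E <> D -> exists p, (E - D) p != 0.
  move=> ED; apply: contrapT => ED0; apply: ED; apply/eqP; rewrite -subr_eq0.
  apply/eqP/bounded_op_ext => p; apply/eqP/negPn/negP => EDp.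
  by apply: ED0; exists p.
have inv'' W : op_invertible W ->
    op_invertible (W - (B - D)) \/ op_invertible (W - (A - D)).
  by move=> /inv'; rewrite or_comm.
have [p Ap] := nz A (nesym DA); have [q Bq] := nz B (nesym DB).
have xB := par_image Ap (indep_pair_pres inv').
have xA r : par ((A - D) p) ((A - D) r).
  apply: par_trans (xB q) _.
  exact: (par_image Bq (indep_pair_pres inv'')).
set x := (A - D) p in Ap xA xB.
have [y1 Ay] := rank1P Hdot Ap xA; have [y2 By] := rank1P Hdot Ap xB.
have y12 : y2 - y1 != 0.
  rewrite subr_eq0; apply/eqP => y12; apply: AB; apply: (addIr (- D)).
  by rewrite Ay By y12.
(* If [r] is orthogonal to [y2 - y1] but not to [y1], then [A - D] and [B - D] take the same nonzero
   value at [r], and an invertible [W] with that value at [r] makes both differences singular. *)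
have [c yc] : par (y2 - y1) y1.
  apply: par_of_ortho => r /eqP; rewrite dotBr subr_eq0 => /eqP r12.
  apply: contrapT => r1.
  have ADr : (A - D) r != 0.
    by rewrite Ay rk1E scaler_eq0 negb_or Ap andbT; apply/eqP => /r1.
  have r0 : r != 0 by apply: contra ADr => /eqP ->; rewrite linear0.
  have [Z [[W [ZW WZ]] Zr]] := transitive1 ADr r0.
  have sing (E : 'B(H)) : E r = (A - D) r -> ~ op_invertible (W - E).
    move=> Er WE; move: r0; suff -> : r = 0 by rewrite eqxx.
    apply: (inv_inj WE); have : (W * Z) ((A - D) r) = (A - D) r by rewrite WZ.
    by rewrite opME Zr => Wr; rewrite [LHS]opBE Wr Er subrr.
  have [|/(sing _ erefl)//|] := inv' W; first by exists Z.
  by apply: sing; rewrite By Ay !rk1E r12.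
have BE : B = A + rk1 x (y2 - y1).
  by rewrite rk1Dr rk1Nr -By -Ay opprB addrA addrC addrA subrK addrC subrK.
have DE : D = A + rk1 (- Num.conj c *: x) (y2 - y1).
  rewrite scaleNr rk1Nl -rk1Zr -yc -Ay.
  by rewrite opprB addrC subrK.
exists x, (y2 - y1), (- Num.conj c); split=> //; apply/andP; split.
- by apply/eqP => c0; apply: DA; rewrite DE c0 scale0r rk1_0l addr0.
- by apply/eqP => c1; apply: DB; rewrite DE BE c1 scale1r.
Qed.

End Collinear.

(** * Maps preserving invertibility of differences: images of lines and parallelism *)

Section Preserver.
Variables (R : realType) (H : completeNormedModType R[i]).
Variable dot : {dot H for (@Num.conj R[i])}.
Hypothesis Hdot : norm_from_dot dot.
Hypothesis dim2 : forall x : H, exists y, ~ par x y.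
Implicit Types (x y z u v w p q : H) (a b c : R[i]) (A B D W X Y Z : 'B(H)).
Implicit Types (f g : 'B(H) -> 'B(H)) (T U : H -> H).
Local Notation rk1 := (rk1 Hdot).

Definition inv_pres f g := [/\ cancel f g, cancel g f &
  forall A B, op_invertible (A - B) <-> op_invertible (f A - f B)].

Lemma inv_pres_sym f g : inv_pres f g -> inv_pres g f.
Proof. by move=> [fg gf fi]; split=> // A B; rewrite [X in _ <-> X]fi !gf. Qed.

Lemma coll_pres f g A B D : inv_pres f g -> coll A B D ->
  coll (f A) (f B) (f D).
Proof.
move=> [fg gf fi] [AB DA DB ABD]; have fI := can_inj fg.
by split=> [/fI|/fI|/fI|X]//; rewrite -(gf X) -!fi; exact: ABD.
Qed.

Lemma pres_rk1 f g A x y : inv_pres f g -> x != 0 -> y != 0 ->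
  exists x' y', [/\ x' != 0, y' != 0 & f (A + rk1 x y) = f A + rk1 x' y'].
Proof.
(* The scalar 2 supplies a third point of the line; any value other than 0 and 1 would do. *)
move=> fg x0 y0; have two0 : (2 : R[i]) != 0 by rewrite pnatr_eq0.
have two1 : (2 : R[i]) != 1 by rewrite (eqr_nat _ 2 1).
have /(coll_pres fg)/(coll_inv Hdot dim2) := coll_rk1 Hdot A x0 y0 two0 two1.
by move=> [x' [y' [c [x'0 y'0 _ E _]]]]; exists x', y'.
Qed.

Lemma rk1_scale c x y u v : rk1 x y = rk1 u v -> rk1 (c *: x) y = rk1 (c *: u) v.
Proof.
move=> E; apply: bounded_op_ext => z.
have := congr1 (fun A : 'B(H) => c *: A z) E.
by rewrite !rk1E !scalerA ![c * _]mulrC.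
Qed.

Lemma pres_line f g A x y x' y' c : inv_pres f g ->
  f (A + rk1 x y) = f A + rk1 x' y' ->
  exists c', f (A + rk1 (c *: x) y) = f A + rk1 (c' *: x') y'.
Proof.
move=> fg fE.
have triv E : E = 0 -> exists c', f (A + E) = f A + rk1 (c' *: x') y'.
  by move=> ->; exists 0; rewrite addr0 scale0r rk1_0l addr0.
have [->|x0] := eqVneq x 0; first by apply: triv; rewrite scaler0 rk1_0l.
have [->|y0] := eqVneq y 0; first by apply: triv; rewrite rk1_0r.
have [->|c0] := eqVneq c 0; first by apply: triv; rewrite scale0r rk1_0l.
have [->|c1] := eqVneq c 1; first by exists 1; rewrite !scale1r.
have /(coll_pres fg)/(coll_inv Hdot dim2) := coll_rk1 Hdot A x0 y0 c0 c1.
move=> [u [v [d [_ _ _]]]]; rewrite fE => /addrI/esym/(rk1_scale d) -> ->.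
by exists d.
Qed.

Section Zero.
Variables f g : 'B(H) -> 'B(H).
Hypotheses (fg : inv_pres f g) (f0 : f 0 = 0).

Lemma pres0 x y : x != 0 -> y != 0 ->
  exists x' y', [/\ x' != 0, y' != 0 & f (rk1 x y) = rk1 x' y'].
Proof.
move=> x0 y0; have := pres_rk1 0 fg x0 y0; rewrite add0r f0.
by move=> [x' [y']]; rewrite add0r; exists x', y'.
Qed.

Lemma line0 x y x' y' c : f (rk1 x y) = rk1 x' y' ->
  exists c', f (rk1 (c *: x) y) = rk1 (c' *: x') y'.
Proof.
have := @pres_line f g 0 x y x' y' c fg; rewrite !add0r f0 add0r => h /h.
by move=> [c']; rewrite add0r; exists c'.
Qed.

End Zero.

Lemma inv_pres0 f g : inv_pres f g -> f 0 = 0 -> g 0 = 0.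
Proof. by move=> [fg _ _] f0; rewrite -[in LHS]f0 fg. Qed.

(* Parallelism of two lines in the same row is visible in the invertibility
   relation: for invertible [X], the line of direction [rk1 x2 y] through a
   point of the row contains both regular and singular points of [X - _]
   exactly when [dot (X^-1 x2) y <> 0]. *)
Lemma pres_parallel f g x1 x2 y x1' x2' x3' y' : inv_pres f g -> f 0 = 0 ->
  y != 0 -> y' != 0 -> x2' != 0 ->
  f (rk1 x1 y) = rk1 x1' y' -> f (rk1 x2 y) = rk1 x2' y' ->
  f (rk1 (x1 + x2) y) = rk1 x3' y' -> par x2' (x3' - x1').
Proof.
move=> fgP f0 y0 y'0 x2'0 f1 f2 f3; apply: contrapT => npar.
set d := x3' - x1' in npar; have [fg gf fi] := fgP.
have dE : x1' + d = x3' by rewrite addrC subrK.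
clearbody d.
have [t yt] := dim2 y'; have [e [ey et]] := separate dot yt.
have e0 : e != 0 by apply: contra et => /eqP ->; rewrite dot0l.
have ye : ~ par e y'.
  move=> [c yc]; move/eqP: y'0; apply; apply/eqP.
  by rewrite -(dotxx_eq0 dot) {1}yc dotZl ey mulr0.
(* This [Z] makes [dot (Z _) y'] constant along [x2'], while along [d] it varies with slope
   [dot y' y'] and so reaches the singular level 1. *)
have [Z [[X' [ZX XZ]] Z2 Zd]] := transitive2 Hdot
  (conj x2'0 npar : indep x2' d) (conj e0 ye : indep e y').
pose X := g X'.
have [W [XW WX]] : op_invertible X.
  by rewrite -(subr0 X) fi f0 subr0 /X gf; exists Z.
have invX x : op_invertible (X - rk1 x y) <-> dot (W x) y <> 1.
  exact: inv_sub_rk1.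
have invX' x' : op_invertible (X' - rk1 x' y') <-> dot (Z x') y' <> 1.
  exact: inv_sub_rk1.
have tr x x' : f (rk1 x y) = rk1 x' y' -> dot (W x) y <> 1 <-> dot (Z x') y' <> 1.
  by move=> fx; rewrite -invX -invX' fi fx /X gf.
have W2 : dot (W x2) y = 0.
  apply/eqP/negPn/negP => W2.
  have [c' fc] := line0 fgP f0 (dot (W x2) y)^-1 f2.
  have /iffRL := tr _ _ fc; apply; last by rewrite linearZ dotZl mulVf.
  by rewrite linearZ Z2 dotZl ey mulr0 => /esym/eqP; rewrite oner_eq0.
have line c : dot (W x1) y <> 1 <-> dot (Z x1') y' + c * dot y' y' <> 1.
  have gfP := inv_pres_sym fgP.
  have : g (rk1 x1' y' + rk1 d y') = g (rk1 x1' y') + rk1 x2 y.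
    by rewrite -rk1Dl dE -f1 -f3 !fg -rk1Dl.
  move=> /(pres_line c gfP)[c']; rewrite -f1 fg -!rk1Dl f1.
  move=> /(congr1 f); rewrite gf -rk1Dl => /esym/tr.
  by rewrite !linearD !linearZ /= Zd !dotDl !dotZl W2 mulr0 addr0.
have yy : dot y' y' != 0 by rewrite dotxx_eq0.
(* These two values of [c] bring the right side of [line] to 1 and to 0, whereas its left side does
   not depend on [c]. *)
have l1 := line ((1 - dot (Z x1') y') / dot y' y').
have l2 := line (- dot (Z x1') y' / dot y' y').
move: l1 l2; rewrite !divfK// subrr addrC subrK => l1 l2.
have : (1 : R[i]) <> 1 by apply/l1/l2 => /eqP; rewrite eq_sym oner_eq0.
exact.
Qed.

End Preserver.

(** * The action on rank-one operators *)

Section Structure.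
Variables (R : realType) (H : completeNormedModType R[i]).
Variable dot : {dot H for (@Num.conj R[i])}.
Hypothesis Hdot : norm_from_dot dot.
Hypothesis dim2 : forall x : H, exists y, ~ par x y.
Implicit Types (x y z u v w p q : H) (a b c : R[i]) (A B D W X Y Z : 'B(H)).
Implicit Types (f g : 'B(H) -> 'B(H)) (T U : H -> H).
Local Notation rk1 := (rk1 Hdot).

(** A form of the fundamental theorem of projective geometry. Parallel summands are treated by
    adding a third vector off their line; the factors of [T (c *: x)] and [T (c *: y)] agree for
    independent [x] and [y] by expanding [T (c *: (x + y))], hence always. *)
Lemma semilinear_of_lines T : T 0 = 0 ->
  (forall c x, exists c', T (c *: x) = c' *: T x) ->
  (forall x y, indep x y -> indep (T x) (T y)) ->
  (forall x y, indep x y -> T (x + y) = T x + T y) ->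
  (forall x y, T (x + y) = T x + T y) /\
  exists tau, forall c x, T (c *: x) = tau c *: T x.
Proof.
move=> T0 Tl Ti Td; have Tadd x y : T (x + y) = T x + T y.
  have [->|x0] := eqVneq x 0; first by rewrite T0 !add0r.
  have [->|y0] := eqVneq y 0; first by rewrite T0 !addr0.
  have [xy|xy] := pselect (par x y); last exact: Td.
  have [z xz] := dim2 x.
  have yz : indep y z.
    by split=> // yz; apply: xz; exact: par_trans xy yz.
  have xyz : indep x (y + z).
    by split=> // /parB/(_ xy); rewrite addrC addKr.
  have : T (x + y + z) = T x + T y + T z by rewrite -addrA Td// Td// addrA.
  have [xy0|xy0] := eqVneq (x + y) 0.
    by rewrite xy0 add0r => /eqP; rewrite -subr_eq subrr T0 => /eqP.
  rewrite Td; first exact: addIr.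
  by split=> // xyz'; apply: xz; apply: par_trans xyz'; apply: parD => //;
    exact: parxx.
split=> //;
  have /choice[k kE] : forall cx : R[i] * H, exists c', T (cx.1 *: cx.2) = c' *: T cx.2.
  by move=> [c x]; exact: Tl.
have kI c x y : indep x y -> k (c, x) = k (c, y).
  move=> xy; have := kE (c, x + y) => /=.
  rewrite scalerDr !Tadd (kE (c, x)) (kE (c, y)) scalerDr /=.
  by move=> /(indep_coef2 (Ti _ _ xy))[-> ->].
have [x0 x00] := dim2 0; have {}x00 : x0 != 0.
  by apply/eqP => x0E; apply: x00; rewrite x0E; exact: par0.
exists (fun c => k (c, x0)) => c x.
have [->|xn0] := eqVneq x 0; first by rewrite scaler0 T0 scaler0.
rewrite (kE (c, x))/=; congr (_ *: _).
have [x0x|x0x] := pselect (par x0 x); last by apply/esym/kI.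
have [z xz] := dim2 x0; rewrite [RHS](kI _ _ z)//; apply: kI.
by split=> // xz'; apply: xz; exact: par_trans x0x xz'.
Qed.

(** The image of the sum differs by rank one from both given images, whose columns are independent,
    so it lies in row [y']. Parallelism puts it on two lines, through [x1'] along [x2'] and through
    [x2'] along [x1'], which meet at [x1' + x2']. *)
Lemma pres_add f g x1 x2 y x1' x2' y' : inv_pres f g -> f 0 = 0 ->
  y != 0 -> y' != 0 -> indep x1 x2 -> indep x1' x2' ->
  f (rk1 x1 y) = rk1 x1' y' -> f (rk1 x2 y) = rk1 x2' y' ->
  f (rk1 (x1 + x2) y) = rk1 (x1' + x2') y'.
Proof.
move=> fgP f0 y0 y'0 x12 x12' f1 f2.
have [x10 x20] := (proj1 x12, indep_neq0r x12).
have [x1'0 x2'0] := (proj1 x12', indep_neq0r x12').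
have x120 : x1 + x2 != 0.
  rewrite addr_eq0; apply/eqP => E; have [_] := indep_sym x12; apply.
  by exists (-1); rewrite E scaleN1r.
have [u [v [u0 v0 f3]]] := pres0 Hdot dim2 fgP f0 x120 y0.
have : par x1' u \/ par y' v.
  have [p [q [_ _]]] := pres_rk1 Hdot dim2 (rk1 x1 y) fgP x20 y0.
  by rewrite -rk1Dl f3 f1 => /sum_rk1; apply.
have : par x2' u \/ par y' v.
  have [p [q [_ _]]] := pres_rk1 Hdot dim2 (rk1 x2 y) fgP x10 y0.
  by rewrite -rk1Dl addrC f3 f2 => /sum_rk1; apply.
move=> h1 h2; have [c vc] : par y' v.
  case: h1 => // x2u; case: h2 => // x1u; exfalso.
  have [_] := x12'; apply; apply: par_trans x1u _.
  exact: par_sym.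
move: f3; rewrite vc rk1Zr; move: (_ *: u) => x3' f3.
have [a xa] := pres_parallel dim2 fgP f0 y0 y'0 x2'0 f1 f2 f3.
have [b xb] := pres_parallel dim2 fgP f0 y0 y'0 x1'0 f2 f1
  (etrans (congr1 (fun x => f (rk1 x y)) (addrC x2 x1)) f3).
have E : 1 *: x1' + a *: x2' = b *: x1' + 1 *: x2'.
  by rewrite -xa -xb !scale1r subrK addrC subrK.
have [_ a1] := indep_coef2 x12' E; rewrite f3; congr (rk1 _ _).
by move: xa; rewrite a1 scale1r => <-; rewrite addrC subrK.
Qed.

(** Evidence that row [y] goes into row [y'] and not into a column. *)
Definition shared_row f y y' := exists x1 x2 x1' x2',
  [/\ indep x1 x2, indep x1' x2', f (rk1 x1 y) = rk1 x1' y' &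
      f (rk1 x2 y) = rk1 x2' y'].

Lemma shared_row_sym f g y y' : inv_pres f g -> shared_row f y y' ->
  shared_row g y' y.
Proof.
move=> [fg _ _] [x1 [x2 [x1' [x2' [x12 x12' f1 f2]]]]].
by exists x1', x2', x1, x2; split; rewrite -?f1 -?f2 ?fg.
Qed.

(** Each [rk1 x y] differs by rank one from both witnesses; as their images have independent
    columns, its image must share their row. *)
Lemma row_map f g y y' : inv_pres f g -> f 0 = 0 -> y != 0 -> y' != 0 ->
  shared_row f y y' -> exists T, forall x, f (rk1 x y) = rk1 (T x) y'.
Proof.
move=> fgP f0 y0 y'0 [x1 [x2 [x1' [x2' [x12 x12' f1 f2]]]]].
have [[x10 _] x20] := (x12, indep_neq0r x12).
have [[x1'0 _] x2'0] := (x12', indep_neq0r x12').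
suff /choice[T TE] : forall x, exists x', f (rk1 x y) = rk1 x' y' by exists T.
move=> x; have [->|x0] := eqVneq x 0; first by exists 0; rewrite !rk1_0l.
have [<-|xx1] := eqVneq x1 x; first by exists x1'.
have [<-|xx2] := eqVneq x2 x; first by exists x2'.
have [u [v [u0 v0 fx]]] := pres0 Hdot dim2 fgP f0 x0 y0.
suff [c vc] : par y' v by exists (Num.conj c *: u); rewrite fx vc rk1Zr.
have aux z z' : z' != 0 -> z != x -> f (rk1 z y) = rk1 z' y' ->
    par z' u \/ par y' v.
  move=> z'0 zx fz; have xz : x - z != 0 by rewrite subr_eq0 eq_sym.
  have [p [q [_ _]]] := pres_rk1 Hdot dim2 (rk1 z y) fgP xz y0.
  by rewrite -rk1Dl addrC subrK fx fz => /sum_rk1; apply.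
case: (aux _ _ x1'0 xx1 f1) => // x1u; case: (aux _ _ x2'0 xx2 f2) => // x2u.
exfalso; have [_] := x12'; apply; apply: par_trans x1u _.
exact: par_sym.
Qed.

Section Row.
Variables (f g : 'B(H) -> 'B(H)) (y y' : H) (T T' : H -> H).
Hypotheses (fgP : inv_pres f g) (f0 : f 0 = 0) (y0 : y != 0) (y'0 : y' != 0).
Hypothesis TE : forall x, f (rk1 x y) = rk1 (T x) y'.
Hypothesis T'E : forall x, g (rk1 x y') = rk1 (T' x) y.

Lemma row_mapK : cancel T T'.
Proof.
move=> x; apply: (rk1_injl (Hdot := Hdot) y0).
by rewrite -T'E -TE; case: fgP.
Qed.

Lemma row_map0 : T 0 = 0.
Proof. by apply: (rk1_injl (Hdot := Hdot) y'0); rewrite -TE !rk1_0l. Qed.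

Lemma row_map_line c x : exists c', T (c *: x) = c' *: T x.
Proof.
have [c' fc] := line0 dim2 fgP f0 c (TE x); exists c'.
by apply: (rk1_injl (Hdot := Hdot) y'0); rewrite -TE.
Qed.

End Row.

Lemma row_map_semilinear f g y y' T T' : inv_pres f g -> f 0 = 0 ->
  y != 0 -> y' != 0 -> (forall x, f (rk1 x y) = rk1 (T x) y') ->
  (forall x, g (rk1 x y') = rk1 (T' x) y) ->
  [/\ forall x1 x2, T (x1 + x2) = T x1 + T x2,
      forall x1 x2, indep x1 x2 -> indep (T x1) (T x2) &
      exists tau, forall c x, T (c *: x) = tau c *: T x].
Proof.
move=> fgP f0 y0 y'0 TE T'E.
have gfP := inv_pres_sym fgP; have g0 := inv_pres0 fgP f0.
have TK := row_mapK fgP y0 TE T'E; have T'K := row_mapK gfP y'0 T'E TE.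
have T0 := row_map0 f0 y'0 TE.
have T_indep x1 x2 : indep x1 x2 -> indep (T x1) (T x2).
  move=> [x10 x12]; split.
    by rewrite -T0 (inj_eq (can_inj TK)).
  move=> [c Tc]; apply: x12; rewrite -(TK x2) Tc.
  have [c' ->] := row_map_line gfP g0 y0 T'E c (T x1).
  by rewrite TK; exists c'.
have [||Tadd Tt] := semilinear_of_lines T0 _ T_indep; last by split.
  by move=> c x; exact: (row_map_line fgP f0 y'0 TE).
move=> x1 x2 x12; apply: (rk1_injl (Hdot := Hdot) y'0); rewrite -TE.
exact: (pres_add fgP f0 y0 y'0 x12 (T_indep _ _ x12)).
Qed.

(** One row determines the images of the columns, and these tie all other rows to it, so that the
    same [T] serves every [v]. *)
Lemma rk1_structure_aux f g y0 y0' T T' : inv_pres f g -> f 0 = 0 ->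
  y0 != 0 -> y0' != 0 -> (forall x, f (rk1 x y0) = rk1 (T x) y0') ->
  (forall x, g (rk1 x y0') = rk1 (T' x) y0) ->
  exists U, forall x v, f (rk1 x v) = rk1 (T x) (U v).
Proof.
move=> fgP f0 y00 y0'0 TE T'E; have [fg gf _] := fgP.
have [Tadd Tind [tau Ttau]] := row_map_semilinear fgP f0 y00 y0'0 TE T'E.
have TK := row_mapK fgP y00 TE T'E.
have T'K := row_mapK (inv_pres_sym fgP) y0'0 T'E TE.
have T0 := row_map0 f0 y0'0 TE.
have Tn0 x : x != 0 -> T x != 0 by rewrite -{2}T0 (inj_eq (can_inj TK)).
suff /choice[U UE] : forall v, exists v', forall x, f (rk1 x v) = rk1 (T x) v'.
  by exists U.
move=> v; have [->|v0] := eqVneq v 0; first by exists 0 => x; rewrite !rk1_0r.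
(* For [v] parallel to [y0] this is semilinearity. Otherwise the images of [rk1 x v] and [rk1 x y0]
   share a column or a row, and row [y0'] is excluded because [g] carries it back to row [y0]. *)
have col x : x != 0 -> exists h, h != 0 /\ f (rk1 x v) = rk1 (T x) h.
  move=> x0; have [u [w [u0 w0 fx]]] := pres0 Hdot dim2 fgP f0 x0 v0.
  have h0 h : f (rk1 x v) = rk1 (T x) h -> h != 0.
    move=> E; apply/eqP => hE; apply: (rk1_neq0 (Hdot := Hdot) u0 w0).
    by rewrite -fx E hE rk1_0r.
  have [[d vd]|vy] := pselect (par y0 v).
    have E : f (rk1 x v) = rk1 (T x) (Num.conj (tau (Num.conj d)) *: y0').
      by rewrite vd rk1Zr TE Ttau rk1Zr conjCK.
    by exists (Num.conj (tau (Num.conj d)) *: y0'); split=> //; exact: h0 E.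
  have vy0 : v - y0 != 0.
    by rewrite subr_eq0; apply/eqP => E; apply: vy; rewrite E; exact: parxx.
  have [p [q [_ _]]] := pres_rk1 Hdot dim2 (rk1 x y0) fgP x0 vy0.
  rewrite -rk1Dr addrC subrK TE fx => /(sum_rk1 (Tn0 _ x0) y0'0)[[c uc]|[c wc]].
    have E : f (rk1 x v) = rk1 (T x) (Num.conj c *: w).
      by rewrite fx uc rk1Zr conjCK.
    by exists (Num.conj c *: w); split; [exact: h0 E | rewrite -fx E].
  exfalso; apply: vy; apply: (@par_of_ortho _ _ dot) => t ty.
  have : rk1 x v = rk1 (T' (Num.conj c *: u)) y0.
    by rewrite -T'E -rk1Zr -wc -fx fg.
  move=> /(congr1 (fun A : 'B(H) => A t)); rewrite !rk1E ty scale0r => /eqP.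
  by rewrite scaler_eq0 (negbTE x0) orbF => /eqP.
have [x1 x10] := dim2 0; have {}x10 : x1 != 0.
  by apply/eqP => x1E; apply: x10; rewrite x1E; exact: par0.
have [x2 x12] := dim2 x1; have {}x12 : indep x1 x2 by [].
have x20 := indep_neq0r x12.
have [h1 [h10 f1]] := col _ x10; have [h2 [h20 f2]] := col _ x20.
(* The images of [rk1 x1 v] and [rk1 x2 v] differ by rank one and have independent columns, so they
   share a row. *)
have [c h2c] : par h1 h2.
  have x21 : x2 - x1 != 0.
    rewrite subr_eq0; apply/eqP => E; have [_] := x12; apply.
    by rewrite E; exact: parxx.
  have [p [q [_ _]]] := pres_rk1 Hdot dim2 (rk1 x1 v) fgP x21 v0.
  rewrite -rk1Dl addrC subrK f1 f2 => /(sum_rk1 (Tn0 _ x10) h10)[|//].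
  by case: (Tind _ _ x12).
have c0 : c != 0 by apply: contra h20 => /eqP c0; rewrite h2c c0 scale0r.
have shv : shared_row f v h1.
  exists x1, x2, (T x1), (Num.conj c *: T x2); split=> //.
    have [Tx1 T12] := Tind _ _ x12; split=> // T12'; apply: T12.
    have := parZ (Num.conj c)^-1 T12'; rewrite scalerA mulVf ?scale1r//.
    by rewrite conjC_eq0.
  by rewrite f2 h2c rk1Zr.
have gfP := inv_pres_sym fgP.
have [Tv TvE] := row_map fgP f0 v0 h10 shv.
have [T'v T'vE] := row_map gfP (inv_pres0 fgP f0) h10 v0 (shared_row_sym fgP shv).
have [Tvadd _ _] := row_map_semilinear fgP f0 v0 h10 TvE T'vE.
have Tv0 := row_map0 f0 h10 TvE.
(* Row [v] has its own map [Tv], by [col] a pointwise multiple of [T]; additivity makes the factor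
   constant, and [U v] absorbs it. *)
have /choice[k kE] : forall x, exists k, Tv x = k *: T x.
  move=> x; have [->|x0] := eqVneq x 0; first by exists 0; rewrite Tv0 scale0r.
  have [h [_]] := col _ x0; rewrite TvE => E.
  exists (dot h1 h / dot h1 h1).
  have := congr1 (fun A : 'B(H) => A h1) E; rewrite !rk1E => /eqP.
  rewrite mulrC -scalerA => /eqP <-.
  by rewrite scalerA mulVf ?scale1r// dotxx_eq0.
have kI x x' : indep x x' -> k x = k x'.
  move=> xx'; have := kE (x + x'); rewrite Tvadd Tadd !kE scalerDr.
  by move=> /(indep_coef2 (Tind _ _ xx'))[-> ->].
exists (Num.conj (k x1) *: h1) => x.
rewrite rk1Zr conjCK TvE kE.
have [->|x0] := eqVneq x 0; first by rewrite T0 !scaler0.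
congr (rk1 (_ *: _) _).
have [x1x|x1x] := pselect (par x1 x); last by apply/esym/kI.
rewrite [RHS](kI _ _ x12); apply: kI; split=> // xx2.
by have [_] := x12; apply; exact: par_trans x1x xx2.
Qed.

Lemma rk1_structure f g y0 y0' : inv_pres f g -> f 0 = 0 ->
  y0 != 0 -> y0' != 0 -> shared_row f y0 y0' ->
  exists T T' U tau tau',
  [/\ cancel T T', cancel T' T, forall x1 x2, T (x1 + x2) = T x1 + T x2,
      (forall c x, T (c *: x) = tau c *: T x) /\
      (forall c x, T' (c *: x) = tau' c *: T' x) &
      (forall x v, f (rk1 x v) = rk1 (T x) (U v)) /\ (forall w, exists v, U v = w)].
Proof.
move=> fgP f0 y00 y0'0 sh; have gfP := inv_pres_sym fgP.
have g0 := inv_pres0 fgP f0; have sh' := shared_row_sym fgP sh.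
have [T TE] := row_map fgP f0 y00 y0'0 sh.
have [T' T'E] := row_map gfP g0 y0'0 y00 sh'.
have [Tadd _ [tau Ttau]] := row_map_semilinear fgP f0 y00 y0'0 TE T'E.
have [_ _ [tau' T'tau]] := row_map_semilinear gfP g0 y0'0 y00 T'E TE.
have TK := row_mapK fgP y00 TE T'E; have T'K := row_mapK gfP y0'0 T'E TE.
have [U UE] := rk1_structure_aux fgP f0 y00 y0'0 TE T'E.
have [U' U'E] := rk1_structure_aux gfP g0 y0'0 y00 T'E TE.
exists T, T', U, tau, tau'; split=> //; split=> // w; exists (U' w).
have [x x0] := dim2 0; have {}x0 : x != 0.
  by apply/eqP => xE; apply: x0; rewrite xE; exact: par0.
have [_ gf _] := fgP; apply: (rk1_injr (Hdot := Hdot) x0).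
by rewrite -{1}(T'K x) -UE -U'E gf.
Qed.

End Structure.

(** * Automatic continuity *)

Section Automatic.
Variables (R : realType) (H : completeNormedModType R[i]).
Variable dot : {dot H for (@Num.conj R[i])}.
Hypothesis Hdot : norm_from_dot dot.
Implicit Types (x y z u v w p q : H) (a b c : R[i]).

(* Gliding hump: a Hellinger-Toeplitz theorem. *)
Lemma bounded_of_weak_adjoint (S : H -> H) :
  (forall v, exists w, forall x, dot (S x) v = dot x w) ->
  exists M, forall x, nr (S x) <= M * nr x.
Proof.
move=> /choice[w wE]; apply: contrapT => unb.
(* The factor [2 * 3 ^+ n] compensates the step size [q ^+ n] for [q = 1/3], and the half of it that
   later steps may undo: they add up to at most [q ^+ n.+1 / (1 - q) = q ^+ n / 2]. *)
have /choice[v vE] n : exists v, n%:R * (2 * 3 ^+ n) * nr v < nr (w v).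
  apply: contrapT => nv; apply: unb; exists (n%:R * (2 * 3 ^+ n)) => x.
  have [->|Sx] := eqVneq (S x) 0;
    first by rewrite nr0 !mulr_ge0 ?nr_ge0// exprn_ge0.
  have Sx0 : 0 < nr (S x) by rewrite lt_def nr_eq0 Sx nr_ge0.
  rewrite -(ler_pM2l Sx0) -expr2 -[leLHS]ger0_norm ?sqr_ge0// -cn_real.
  rewrite -(dotxx Hdot) wE (le_trans (cn_dot Hdot _ _))//.
  rewrite [leRHS]mulrA [leRHS]mulrC ler_wpM2l ?nr_ge0// mulrC leNgt;
    apply/negP => lt.
  by apply: nv; exists (S x).
have nw n : 0 < nr (w (v n)).
  by rewrite (le_lt_trans _ (vE n))// !mulr_ge0 ?nr_ge0// exprn_ge0.
pose q : R := 3^-1.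
have q01 : 0 <= q < 1 by rewrite /q; lra.
have q0 n : 0 <= q ^+ n by rewrite exprn_ge0// /q invr_ge0.
pose p n := (q ^+ n / nr (w (v n)))%:C *: w (v n).
have np n : nr (p n) = q ^+ n.
  by rewrite nrZ cn_real ger0_norm ?divr_ge0 ?nr_ge0// divfK// gt_eqF.
have dp n : cn (dot (p n) (w (v n))) = q ^+ n * nr (w (v n)).
  rewrite dotZl dotxx// -rmorphM cn_real ger0_norm; last first.
    by rewrite mulr_ge0 ?divr_ge0 ?nr_ge0 ?sqr_ge0.
  by rewrite expr2 mulrA divfK// gt_eqF.
(* One of [x + p n] and [x - p n] works, because their products with [w (v n)] differ by
   [2 * dot (p n) (w (v n))]. *)
have /choice[step stepE] (nx : nat * H) : exists y,
    nr (y - nx.2) <= q ^+ nx.1 /\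
    q ^+ nx.1 * nr (w (v nx.1)) <= cn (dot y (w (v nx.1))).
  case: nx => n x /=.
  have : 2 * (q ^+ n * nr (w (v n))) <=
      cn (dot (x + p n) (w (v n))) + cn (dot (x - p n) (w (v n))).
    rewrite -dp -(cnN (dot (x - _) _)); apply: le_trans (cnD _ _).
    rewrite dotDl dotBl (_ : _ - _ = 2 * dot (p n) (w (v n))); last by ring.
    by rewrite cnM -(rmorph_nat (@real_complex R)) cn_real normr_nat.
  have [le1 _|lt1 le2] := leP (q ^+ n * nr (w (v n))) (cn (dot (x + p n) (w (v n)))).
    by exists (x + p n); rewrite addrC addKr np.
  by exists (x - p n); rewrite addrC addKr nrN np; split=> //; lra.
pose u := fix u n := if n is m.+1 then step (m, u m) else 0.
have [l lE] : exists l, forall n, nr (l - u n) <= q ^+ n / (1 - q).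
  by apply: complete_geometric => // n; have [] := stepE (n, u n).
have Sl n : n%:R < nr (S l).
  have [_ /= un] := stepE (n, u n); rewrite -[step _]/(u n.+1) in un.
  have lw : cn (dot l (w (v n))) <= nr (S l) * nr (v n).
    by rewrite -wE; exact: cn_dot.
  have lu : cn (dot (u n.+1) (w (v n))) <=
      cn (dot l (w (v n))) + nr (l - u n.+1) * nr (w (v n)).
    rewrite -{1}[u n.+1](subKr l) dotBl (le_trans (cnD _ _))// lerD2l cnN.
    exact: cn_dot.
  have lq : nr (l - u n.+1) * nr (w (v n)) <= q ^+ n / 2 * nr (w (v n)).
    rewrite ler_wpM2r ?nr_ge0// (le_trans (lE _))// exprS ler_pdivrMr.
      by move: (q ^+ n) => Q; rewrite /q; lra.
    by rewrite /q; lra.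
  have qv : n%:R * nr (v n) < q ^+ n / 2 * nr (w (v n)).
    have q3 : q ^+ n / 2 * (2 * 3 ^+ n) = 1.
      by rewrite mulrA divfK ?pnatr_eq0// -exprMn mulVf ?pnatr_eq0// expr1n.
    have q2 : 0 < q ^+ n / 2.
      by rewrite divr_gt0// exprn_gt0// /q invr_gt0.
    have -> : n%:R * nr (v n) = q ^+ n / 2 * (2 * 3 ^+ n * (n%:R * nr (v n))).
      by rewrite [RHS]mulrA q3 mul1r.
    rewrite (ltr_pM2l q2) mulrCA mulrA.
    exact: vE.
  have Sv : n%:R * nr (v n) < nr (S l) * nr (v n) by lra.
  have nv : 0 < nr (v n).
    rewrite lt_def nr_ge0 andbT; apply/eqP => nv0.
    by move: Sv; rewrite nv0 !mulr0 ltxx.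
  by rewrite -(ltr_pM2r nv).
have := Sl (Num.truncn (nr (S l))).+1.
by rewrite ltNge ltW// truncnS_gt.
Qed.

(** Peels off one coefficient at a time, which suits induction; the list may be linearly
    dependent. *)
Fixpoint in_span (s : seq H) x :=
  if s is v :: s' then exists c, in_span s' (x - c *: v) else x = 0.

Lemma in_span_lin s c x y : in_span s x -> in_span s y -> in_span s (x - c *: y).
Proof.
elim: s x y => [|v s IH] x y /=; first by move=> -> ->; rewrite scaler0 subrr.
move=> [a xa] [b yb]; exists (a - c * b); have := IH _ _ xa yb.
congr in_span; rewrite scalerBr scalerBl scalerA !opprB.
by rewrite (addrC ((c * b) *: v)) addrACA [X in _ + X]addrC.
Qed.

Lemma in_span_sum s x : in_span s x ->
  exists c : 'I_(size s) -> R[i], x = \sum_i c i *: s`_i.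
Proof.
elim: s x => [|v s IH] x /=.
  by move=> ->; exists (fun=> 0); rewrite big_ord0.
move=> [a /IH[c xc]].
exists (fun i => if unlift ord0 i is Some j then c j else a).
rewrite big_ord_recl unlift_none /=; move/eqP: xc; rewrite subr_eq => /eqP ->.
by rewrite addrC; congr (_ + _); apply: eq_bigr => i _; rewrite liftK.
Qed.

Lemma ortho_span s x z : (forall v, v \in s -> dot x v = 0) -> in_span s z ->
  dot x z = 0.
Proof.
elim: s z => [|v s IH] z /= xs; first by move=> ->; rewrite dot0r.
move=> [c /IH]; rewrite dotBr dotZr (xs v) ?mem_head// mulr0 subr0; apply.
by move=> t ts; apply: xs; rewrite inE ts orbT.
Qed.

(** Gram-Schmidt without independence: if [v] already lies in the span of [s], then [v - zv = 0] and
    the division by zero in [c] yields 0, as it should. *)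
Lemma span_projection s x :
  exists z, in_span s z /\ forall v, v \in s -> dot (x - z) v = 0.
Proof.
elim: s x => [|v s IH] x; first by exists 0.
have [zv [szv zvE]] := IH v; have [zx [szx zxE]] := IH x.
pose c := dot (x - zx) (v - zv) / dot (v - zv) (v - zv).
have rE : x - (x - resid dot (v - zv) (x - zx)) = x - zx - c *: (v - zv).
  by rewrite opprB addrC subrK.
have rs t : t \in s -> dot (x - zx - c *: (v - zv)) t = 0.
  by move=> ts; rewrite dotBl dotZl zvE// zxE// mulr0 subr0.
exists (x - resid dot (v - zv) (x - zx)); split.
  exists c; have := in_span_lin c szx szv; congr in_span.
  rewrite /resid -/c opprB addrCA subKr scalerBr [RHS]addrC addrA addKr.
  exact: addrC.
move=> t; rewrite rE inE => /predU1P[->|/rs//].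
have := dot_resid dot (v - zv) (x - zx); rewrite /resid -/c dotBr.
by rewrite (ortho_span rs szv) subr0.
Qed.

Lemma orthonormal_sequence : infinite_dimensional H ->
  exists e : nat -> H, (forall n, nr (e n) = 1) /\
    forall m n, m <> n -> dot (e m) (e n) = 0.
Proof.
move=> Hinf.
have /choice[next nextE] (s : seq H) : exists y, nr y = 1 /\
    forall v, v \in s -> dot y v = 0.
  have [x xs] := Hinf _ (fun i : 'I_(size s) => s`_i).
  have [z [/in_span_sum[c zc] zE]] := span_projection s x.
  have xz : x - z != 0.
    by rewrite subr_eq0; apply/eqP => xzE; apply: (xs c); rewrite xzE.
  have n0 : 0 < nr (x - z) by rewrite lt_def nr_eq0 xz nr_ge0.
  exists ((nr (x - z))^-1%:C *: (x - z)); split.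
    by rewrite nrZ cn_real ger0_norm ?invr_ge0 ?nr_ge0// mulVf// gt_eqF.
  by move=> v vs; rewrite dotZl zE// mulr0.
pose L := fix L n := if n is m.+1 then next (L m) :: L m else [::].
exists (fun n => next (L n)); split; first by move=> n; have [] := nextE (L n).
have mem m n : (m < n)%N -> next (L m) \in L n.
  elim: n => // n IH; rewrite ltnS leq_eqVlt => /predU1P[->|/IH].
    exact: mem_head.
  by rewrite /= inE => ->; rewrite orbT.
move=> m n /eqP; rewrite neq_ltn => /orP[|] /mem lt.
  by rewrite dotC (proj2 (nextE _) _ lt) rmorph0.
exact: (proj2 (nextE _) _ lt).
Qed.

(** Otherwise there are [la n] of size at most [2^-n] with [cn (tau (la n)) > n * nr (U (e n))]. The
    vector [l] with coordinates [la n] then satisfies [n < nr (T l)] for all [n] by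
    Cauchy-Schwarz. *)
Lemma locally_bounded_of_semilinear (tau : R[i] -> R[i]) (T U : H -> H) :
  infinite_dimensional H ->
  (forall x y, dot (T x) (U y) = tau (dot x y)) ->
  exists d M : R, 0 < d /\ forall a, cn a <= d -> cn (tau a) <= M.
Proof.
move=> /orthonormal_sequence[e [e1 e0]] TU; apply: contrapT => unb.
pose q : R := 2^-1.
have q01 : 0 <= q < 1 by rewrite /q; lra.
have /choice[la laE] n : exists a, cn a <= q ^+ n /\ n%:R * nr (U (e n)) < cn (tau a).
  apply: contrapT => na; apply: unb; exists (q ^+ n), (n%:R * nr (U (e n))).
  split; first by rewrite exprn_gt0// /q invr_gt0.
  by move=> a aq; rewrite leNgt; apply/negP => lt; apply: na; exists a.
pose u n := \sum_(k < n) la k *: e k.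
have [l lE] : exists l, forall n, nr (l - u n) <= q ^+ n / (1 - q).
  apply: complete_geometric => // n.
  by rewrite /u big_ord_recr /= [X in nr X]addrC addKr nrZ e1 mulr1;
    have [] := laE n.
have due m n : (n < m)%N -> dot (u m) (e n) = la n.
  elim: m => // m IH; rewrite /u big_ord_recr /= dotDl dotZl ltnS leq_eqVlt.
  move=> /predU1P[->|nm].
    rewrite dotxx// e1 expr1n mulr1 (_ : dot _ _ = 0) ?add0r//.
    rewrite dot_suml big1// => i _.
    by rewrite dotZl e0 ?mulr0// => im; have := ltn_ord i; rewrite im ltnn.
  rewrite -/(u m) IH// e0 ?mulr0 ?addr0// => mn.
  by move: nm; rewrite mn ltnn.
have lle n : dot l (e n) = la n.
  apply/eqP; rewrite -subr_eq0 -cn_eq0 eq_le cn_ge0 andbT leNgt;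
    apply/negP => pos.
  have pos2 : 0 < cn (dot l (e n) - la n) * (1 - q).
    by rewrite mulr_gt0// /q; lra.
  have [N qN] := geometric_small q01 pos2.
  have := qN (maxn N n.+1) (leq_maxl _ _); apply/negP; rewrite -leNgt.
  rewrite -ler_pdivlMr; last by rewrite /q; lra.
  rewrite -(due (maxn N n.+1) n) ?leq_maxr// -dotBl.
  by rewrite (le_trans (cn_dot Hdot _ _))// e1 mulr1.
have Tl n : n%:R < nr (T l).
  have [_] := laE n; rewrite -lle -TU => lt.
  have {}lt := lt_le_trans lt (cn_dot Hdot (T l) (U (e n))).
  have nv : 0 < nr (U (e n)).
    rewrite lt_def nr_ge0 andbT; apply/eqP => nv0.
    by move: lt; rewrite nv0 !mulr0 ltxx.
  by rewrite -(ltr_pM2r nv).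
have := Tl (Num.truncn (nr (T l))).+1.
by rewrite ltNge ltW// truncnS_gt.
Qed.

(** Since [tau] fixes the integers, the bound passes to the unit disc. For real [r] the number
    [n * r] is within 1 of an integer, so [n * cn (tau r - r)] stays bounded in [n] and [tau r = r].
    Finally [tau 'i] is a square root of -1. *)
Lemma locally_bounded_endomorphism (tau : {rmorphism R[i] -> R[i]}) (d M : R) :
  0 < d -> (forall a, cn a <= d -> cn (tau a) <= M) ->
  (forall a, tau a = a) \/ (forall a, tau a = Num.conj a).
Proof.
move=> d0 tauM.
have tauR (r : R) : tau r%:C = r%:C.
  pose N := (Num.truncn d^-1).+1.
  have Nd : d^-1 < N%:R by exact: truncnS_gt.
  have N0 : 0 < N%:R :> R by rewrite (lt_trans _ Nd)// invr_gt0.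
  have bnd a : cn a <= 1 -> cn (tau a) <= N%:R * M.
    move=> a1; have -> : a = N%:R * (N%:R^-1 * a).
      by rewrite mulrA divff ?mul1r// pnatr_eq0.
    rewrite rmorphM rmorph_nat cnM -(rmorph_nat (@real_complex R)) cn_real.
    rewrite normr_nat ler_pM2l//; apply: tauM.
    rewrite -fmorphV cnM cn_real ger0_norm ?invr_ge0//.
    rewrite ler_pdivrMl// (le_trans a1)//.
    by rewrite -ler_pdivrMr// div1r ltW.
  have key n : n%:R * cn (tau r%:C - r%:C) <= N%:R * M + 1.
    pose m := Num.floor (n%:R * r); pose s := n%:R * r - m%:~R.
    have s01 : 0 <= s < 1.
      have := floor_itv (n%:R * r); rewrite -/m intrD /s; lra.
    have cs : cn s%:C <= 1.
      by case/andP: s01 => s0 s1; rewrite cn_real ger0_norm// ltW.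
    have -> : n%:R * cn (tau r%:C - r%:C) = cn (tau s%:C - s%:C).
      rewrite /s rmorphB rmorphM rmorph_nat rmorph_int /= rmorphB rmorphM.
      rewrite rmorph_nat rmorph_int opprB addrA subrK -mulrBr cnM.
      by rewrite -(rmorph_nat (@real_complex R)) cn_real normr_nat.
    by rewrite (le_trans (cnD _ _))// cnN lerD// bnd.
  apply/eqP; rewrite -subr_eq0 -cn_eq0 eq_le cn_ge0 andbT leNgt;
    apply/negP => pos.
  have := key (Num.truncn ((N%:R * M + 1) / cn (tau r%:C - r%:C))).+1.
  apply/negP; rewrite -ltNge -ltr_pdivrMr//.
  exact: truncnS_gt.
have tauE a : tau a = (complex.Re a)%:C + tau 'i%C * (complex.Im a)%:C.
  by rewrite {1}(complexE a) rmorphD rmorphM !tauR.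
have : (tau 'i%C - 'i%C) * (tau 'i%C + 'i%C) = 0.
  by rewrite -subr_sqr -rmorphXn sqr_i rmorphN1 subrr.
move=> /eqP; rewrite mulf_eq0 subr_eq0 addr_eq0 => /orP[]/eqP ti;
  [left|right] => a.
  by rewrite tauE ti -complexE.
rewrite tauE ti.
case: a => x y; apply/eqP; rewrite eq_complex /=.
by apply/andP; split; apply/eqP; ring.
Qed.

End Automatic.

(** * From rank-one operators to all operators *)

Section Spectral.
Variables (R : realType) (H : completeNormedModType R[i]).
Variable dot : {dot H for (@Num.conj R[i])}.
Hypothesis Hdot : norm_from_dot dot.
Hypothesis dim2 : forall x : H, exists y, ~ par x y.
Implicit Types (x y z u v w p q : H) (a b c : R[i]) (A B D K W X Y Z : 'B(H)).
Implicit Types (f g : 'B(H) -> 'B(H)) (T U V S : H -> H).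
Local Notation rk1 := (rk1 Hdot).

(** Solves [x = y + K x] by iteration from 0; the constant 1/2 gives the inverse the bound 2. *)
Lemma inv_neumann K : (forall x, nr (K x) <= 2^-1 * nr x) -> op_invertible (1 - K).
Proof.
move=> K2; have q01 : 0 <= (2^-1 : R) < 1 by lra.
have low x : nr x <= 2 * nr ((1 - K) x).
  by rewrite opBE Defs.op1E; have := nrD (x - K x) (K x); have := K2 x;
    rewrite subrK; lra.
have inj x y : (1 - K) x = (1 - K) y -> x = y.
  move=> E; apply/eqP; rewrite -subr_eq0 -nr_eq0 eq_le nr_ge0 andbT.
  by rewrite (le_trans (low _))// linearB E subrr nr0 mulr0.
(* Normalizing [y] keeps the iteration steps below [2^-n], as [complete_geometric] requires. *)
have surj1 y : nr y <= 1 -> exists x, (1 - K) x = y.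
  move=> y1; pose u n := iter n (fun x => y + K x) 0.
  have uq n : nr (u n.+1 - u n) <= 2^-1 ^+ n.
    elim: n => [|n IH]; first by rewrite /u /= linear0 addr0 subr0 expr0.
    have -> : u n.+2 - u n.+1 = K (u n.+1 - u n).
      by rewrite linearB /u /= opprD addrACA subrr add0r.
    rewrite (le_trans (K2 _))// exprS ler_wpM2l//; lra.
  have [l lE] := complete_geometric q01 uq.
  exists l; apply/eqP;
    rewrite opBE Defs.op1E -subr_eq0 -nr_eq0 eq_le nr_ge0 andbT.
  rewrite leNgt; apply/negP => pos.
  have pos4 : 0 < nr (l - K l - y) / 4 by rewrite divr_gt0.
  have [N qN] := geometric_small q01 pos4.
  have := lE N; have := lE N.+1; have := qN N (leqnn N).
  have : nr (l - K l - y) <= nr (l - u N.+1) + 2^-1 * nr (l - u N).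
    have -> : l - K l - y = (l - u N.+1) + - K (l - u N).
      by rewrite linearB opprB /u /= opprD !addrA subrK addrAC.
    by rewrite (le_trans (nrD _ _))// lerD2l nrN.
  rewrite exprS; move: (2^-1 ^+ N) => Q.
  rewrite (_ : (1 - 2^-1)^-1 = 2 :> R); first by lra.
  by apply: invr_inj; rewrite invrK; lra.
have surj y : exists x, (1 - K) x = y.
  have [->|y0] := eqVneq y 0; first by exists 0; rewrite linear0.
  have ny : nr y != 0 by rewrite nr_eq0.
  have [|x xE] := surj1 ((nr y)^-1%:C *: y).
    by rewrite nrZ cn_real ger0_norm ?invr_ge0 ?nr_ge0// mulVf.
  exists ((nr y)%:C *: x); rewrite linearZ xE /= scalerA -rmorphM mulfV//.
  exact: scale1r.
have /choice[h hE] := surj.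
have [||B BE] := @mk_op _ _ h 2.
- by move=> a x y; apply: inj; rewrite hE linearP !hE.
- by move=> y; rewrite (le_trans (low _))// hE.
exists B; split; apply: bounded_op_ext => x; rewrite opME BE ?hE//.
by apply: inj; rewrite hE.
Qed.

Lemma scalar_op_exists c : exists A : 'B(H), forall x, A x = c *: x.
Proof.
apply: (@mk_op _ _ _ (cn c)) => [a x y|x]; last by rewrite nrZ.
by rewrite scalerDr !scalerA mulrC.
Qed.

(** The scalar [2 * (M + N + 1)] exceeds twice both operator bounds, so [inv_neumann] applies after
    division by it. *)
Lemma inv_large_sub A B : exists c (C : 'B(H)), [/\ c != 0, forall x, C x = c *: x,
  op_invertible (C - A) & op_invertible (C - B)].
Proof.
have [M M0 AM] := op_nr_bound A; have [N N0 BN] := op_nr_bound B.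
pose r := 2 * (M + N + 1); have r0 : 0 < r by rewrite /r; lra.
have rC0 : r%:C != 0 by rewrite (inj_eq (@complexI R)) gt_eqF.
have [C CE] := scalar_op_exists r%:C.
have [C' C'E] := scalar_op_exists (r^-1)%:C.
have CC' : C * C' = 1.
  apply: bounded_op_ext => x.
  by rewrite opME CE C'E scalerA -rmorphM mulfV ?gt_eqF// scale1r.
have C'C : C' * C = 1.
  apply: bounded_op_ext => x.
  by rewrite opME CE C'E scalerA -rmorphM mulVf ?gt_eqF// scale1r.
have small D L : L <= M + N -> (forall x, nr (D x) <= L * nr x) -> op_invertible (C - D).
  move=> LMN DL; rewrite -(invMl _ C'C CC') mulrBr C'C; apply: inv_neumann => x.
  rewrite opME C'E nrZ cn_real ger0_norm ?invr_ge0 ?(ltW r0)//.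
  rewrite mulrC ler_pdivrMr// (le_trans (DL _))// mulrAC.
  by rewrite ler_wpM2r ?nr_ge0// /r; lra.
exists r%:C, C; split=> //; [apply: (small A M)|apply: (small B N)] => //; lra.
Qed.

Lemma avoid2 a b : exists t : R[i], [/\ t != 0, t != a & t != b].
Proof.
have neq (m n : nat) : m != n -> (m%:R : R[i]) != n%:R by rewrite eqr_nat.
have n1 : (1%:R : R[i]) != 0 by apply: (neq 1 0).
have n2 : (2%:R : R[i]) != 0 by apply: (neq 2 0).
have n3 : (3%:R : R[i]) != 0 by apply: (neq 3 0).
have [a1|a1] := eqVneq 1%:R a.
  have [b2|b2] := eqVneq 2%:R b.
    by exists 3%:R; rewrite -a1 -b2 n3 !neq.
  by exists 2%:R; rewrite -a1 n2 b2 neq.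
have [b1|b1] := eqVneq 1%:R b; last by exists 1%:R; rewrite a1 b1 n1.
have [a2|a2] := eqVneq 2%:R a; last by exists 2%:R; rewrite -b1 n2 a2 neq.
by exists 3%:R; rewrite -a2 -b1 n3 !neq.
Qed.

(** A vector [f] orthogonal to neither [u] nor [v] is shifted along [w] if necessary; [u] and [v]
    exclude at most one shift [t] each, and [t != 0] takes care of [w]. *)
Lemma common_nonortho u v w : u != 0 -> v != 0 -> w != 0 ->
  exists y, [/\ dot u y != 0, dot v y != 0 & dot w y != 0].
Proof.
move=> u0 v0 w0; have [f [uf vf]] := separate_scaled dot u0 v0.
have uf0 : dot u f != 0 by rewrite uf oner_eq0.
have [wf|wf] := eqVneq (dot w f) 0; last by exists f.
have [t [t0 tu tv]] := avoid2 (- dot u f / dot u w) (- dot v f / dot v w).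
have nz z : dot z f != 0 -> t != - dot z f / dot z w ->
    dot z (f + Num.conj t *: w) != 0.
  move=> zf tz; rewrite dotDr dotZr conjCK.
  have [->|zw] := eqVneq (dot z w) 0; first by rewrite mulr0 addr0.
  by apply: contra tz => /eqP E; rewrite eq_sym -(inj_eq (mulIf zw)) divfK//;
    rewrite eq_sym -addr_eq0 addrC E.
exists (f + Num.conj t *: w); split; [exact: nz|exact: nz|].
by rewrite dotDr wf add0r dotZr conjCK mulf_neq0// dotxx_eq0.
Qed.

(* Let [D = f A - A] and let [C] be a large scalar operator [c].  If [A x] and
   [D x] were nonzero, some [z] with [dot x z = c] would make
   [B := A - C + rk1 x z] and [f A - B] invertible, although [A - B = C - rk1 x z] kills [x]. *)
Lemma pres_eq_id f g : inv_pres f g -> f 0 = 0 ->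
  (forall A, op_invertible A -> f A = A) -> forall A, f A = A.
Proof.
move=> [_ _ fi] f0 fid A; apply/eqP; rewrite -subr_eq0; apply/eqP.
have [-> |/eqP A0] := eqVneq A 0; first by rewrite f0 subrr.
set D := f A - A; have [c [C [c0 CE CA CD]]] := inv_large_sub A (- D).
have Dx x : A x != 0 -> D x = 0.
  move=> Ax; have x0 : x != 0 by apply: contra Ax => /eqP ->; rewrite linear0.
  have [W [AW WA]] := CA; have [V [DV VD]] := CD.
  pose a := c^-1 *: x; have a0 : a != 0 by rewrite scaler_eq0 negb_or invr_neq0.
  have Ca : C a = x by rewrite CE scalerA mulfV// scale1r.
  have Wa : W x - a != 0.
    rewrite subr_eq0; apply/eqP => E; move: Ax.
    have : (C - A) (W x) = x by rewrite -opME AW.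
    rewrite E opBE Ca => /eqP; rewrite -subr_eq0 addrC addKr oppr_eq0.
    by rewrite linearZ /= scaler_eq0 invr_eq0 (negbTE c0) /= => ->.
  (* [V x = a] means [(C + D) a = x = C a], so [D a = 0] at once. *)
  have [Va|Va] := eqVneq (V x - a) 0.
    move/eqP: Va; rewrite subr_eq0 => /eqP Va.
    have : (C - - D) (V x) = x by rewrite -opME DV.
    rewrite Va opBE Ca opNE opprK => /eqP; rewrite -subr_eq0 addrC addKr.
    by rewrite linearZ /= scaler_eq0 invr_eq0 (negbTE c0) => /eqP.
  have [y [ya yW yV]] := common_nonortho a0 Wa Va; exfalso.
  pose z := (Num.conj (dot a y))^-1 *: y.
  have zE t : dot t z = (dot a y)^-1 * dot t y by rewrite dotZr fmorphV /= conjCK.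
  have az : dot a z = 1 by rewrite zE mulVf.
  have Wz : dot (W x) z <> 1.
    rewrite -az => /eqP; rewrite -subr_eq0 -dotBl zE mulf_eq0 invr_eq0.
    by rewrite (negbTE ya) (negbTE yW).
  have Vz : dot (V x) z <> 1.
    rewrite -az => /eqP; rewrite -subr_eq0 -dotBl zE mulf_eq0 invr_eq0.
    by rewrite (negbTE ya) (negbTE yV).
  pose B := A - (C - rk1 x z).
  have Bi : op_invertible B.
    rewrite /B inv_subC addrAC; apply/(inv_sub_rk1 _ _ _ AW WA); exact: Wz.
  have : op_invertible (f A - f B).
    rewrite (fid _ Bi) /B opprB addrCA -/D.
    have -> : C - rk1 x z + D = C - - D - rk1 x z by rewrite opprK addrAC.
    by apply/(inv_sub_rk1 _ _ _ DV VD).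
  rewrite -fi /B opprB addrCA subrr addr0 => inv.
  have a00 : a = 0.
    by apply: (inv_inj inv); rewrite opBE Ca rk1E az scale1r subrr.
  by rewrite a00 eqxx in a0.
have [x0 Ax0] : exists x, A x != 0.
  apply: contrapT => A00; apply: A0; apply: bounded_op_ext => x.
  by apply/eqP/negPn/negP => Ax; apply: A00; exists x.
apply: bounded_op_ext => x; rewrite op0E.
(* [D] vanishes off the kernel of [A]; a kernel vector [x] is the difference of [x + x0] and [x0],
   both off it. *)
have [Ax|/Dx//] := eqVneq (A x) 0.
have := Dx (x + x0); rewrite !linearD Ax add0r => /(_ Ax0).
by rewrite (Dx _ Ax0) addr0.
Qed.

(** Surjectivity of [V] gives [S] a weak adjoint, and [V] itself is one for [S'], so both are
    bounded. Conjugating [f] back by them gives a map that fixes all invertible operators. *)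
Lemma similarity_of_weak_adjoint f g S S' V : inv_pres f g -> f 0 = 0 ->
  linear S -> cancel S S' -> cancel S' S ->
  (forall x y, dot (S x) (V y) = dot x y) -> (forall w, exists v, V v = w) ->
  (forall A, op_invertible A -> forall x, f A (S x) = S (A x)) ->
  exists S0 S1 : 'B(H), [/\ S0 * S1 = 1, S1 * S0 = 1 & forall A, f A = S0 * A * S1].
Proof.
move=> [fg gf fi] f0 Slin SK S'K SV Vsurj fS.
have [M SM] := bounded_of_weak_adjoint Hdot
  (fun v => let: ex_intro w wE := Vsurj v in
    ex_intro _ w (fun x => etrans (congr1 (dot (S x)) (esym wE)) (SV x w))).
have [M' SM'] := bounded_of_weak_adjoint Hdot
  (fun v => ex_intro (fun w => forall x, dot (S' x) v = dot x w) (V v)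
    (fun x => etrans (esym (SV (S' x) v)) (congr1 (fun z => dot z (V v)) (S'K x)))).
have [S0 S0E] := mk_op Slin SM.
have S'lin : linear S'.
  by move=> a x y; apply: (can_inj SK); rewrite S'K Slin !S'K.
have [S1 S1E] := mk_op S'lin SM'.
have S01 : S0 * S1 = 1 by apply: bounded_op_ext => x; rewrite opME S0E S1E S'K.
have S10 : S1 * S0 = 1 by apply: bounded_op_ext => x; rewrite opME S0E S1E SK.
have conjK A : S0 * (S1 * A * S0) * S1 = A.
  by rewrite !mulrA S01 mul1r -mulrA S01 mulr1.
have conjK' A : S1 * (S0 * A * S1) * S0 = A.
  by rewrite !mulrA S10 mul1r -mulrA S10 mulr1.
exists S0, S1; split=> // A.
have hid := @pres_eq_id (fun A => S1 * f A * S0) (fun A => g (S0 * A * S1)).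
rewrite -[in RHS](hid _ _ _ A) ?conjK//.
- split=> [B|B|B D]; rewrite ?conjK ?fg ?gf ?conjK'// -mulrBl -mulrBr fi.
  split=> [inv|inv]; first by apply: invM; [apply: invM => //; exists S0|exists S1].
  rewrite -(conjK (f B - f D)).
  by apply: invM; [apply: invM => //; exists S1|exists S0].
- by rewrite f0 mulr0 mul0r.
- move=> B Bi; apply: bounded_op_ext => x.
  by rewrite !opME S0E fS// S1E SK.
Qed.

(** The tests compare only where the value 1 is taken; applying them to multiples of [x] gives the
    full identity [polar]. That a zero value goes to zero uses that [tau] is onto, which
    semilinearity of [T'] provides. The case [A = 1] is the identity without inverses. *)
Lemma intertwine f g T T' U tau tau' : inv_pres f g -> f 0 = 0 -> f 1 = 1 ->
  cancel T T' -> cancel T' T ->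
  (forall x y, T (x + y) = T x + T y) ->
  (forall c x, T (c *: x) = tau c *: T x) ->
  (forall c x, T' (c *: x) = tau' c *: T' x) ->
  (forall x v, f (rk1 x v) = rk1 (T x) (U v)) -> (forall w, exists v, U v = w) ->
  [/\ zmod_morphism tau, monoid_morphism tau,
      forall x y, dot (T x) (U y) = tau (dot x y) &
      forall A, op_invertible A -> forall x, f A (T x) = T (A x)].
Proof.
move=> fgP f0 f1 TK T'K Tadd Ttau T'tau TU Usurj; have [fg gf fi] := fgP.
have [x0 x00] := dim2 0; have {}x00 : x0 != 0.
  by apply/eqP => xE; apply: x00; rewrite xE; exact: par0.
have T0 : T 0 = 0.
  by apply: (addrI (T 0)); rewrite -Tadd !addr0.
have Tx0 : T x0 != 0 by rewrite -T0 (inj_eq (can_inj TK)).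
have TI c d : c *: T x0 = d *: T x0 -> c = d.
  move=> /eqP; rewrite -subr_eq0 -scalerBl scaler_eq0 (negbTE Tx0) orbF.
  by rewrite subr_eq0 => /eqP.
have tau1 : tau 1 = 1 by apply: TI; rewrite -Ttau !scale1r.
have tauD c d : tau (c + d) = tau c + tau d.
  by apply: TI; rewrite -Ttau !scalerDl Tadd !Ttau.
have tau0 : tau 0 = 0 by apply: TI; rewrite -Ttau !scale0r.
have tauN c : tau (- c) = - tau c.
  by apply/eqP; rewrite -addr_eq0 -tauD addNr tau0.
have tauM c d : tau (c * d) = tau c * tau d.
  by apply: TI; rewrite -Ttau -!scalerA !Ttau.
have tauK c : tau (tau' c) = c.
  by apply: TI; rewrite -Ttau -[RHS]T'K T'tau TK.
have iffE A W W' x y : A * W = 1 -> W * A = 1 -> f A * W' = 1 -> W' * f A = 1 ->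
    (dot (W x) y = 1 <-> dot (W' (T x)) (U y) = 1).
  move=> AW WA fW Wf; have := fi A (rk1 x y).
  rewrite TU (inv_sub_rk1 _ _ _ AW WA) (inv_sub_rk1 _ _ _ fW Wf).
  move=> h; split=> E; apply: contrapT => /h; exact.
have polar A W W' x y : A * W = 1 -> W * A = 1 -> f A * W' = 1 -> W' * f A = 1 ->
    dot (W' (T x)) (U y) = tau (dot (W x) y).
  move=> AW WA fW Wf; have E z := iffE _ _ _ z y AW WA fW Wf.
  have [k0|k0] := eqVneq (dot (W x) y) 0; last first.
    have tk0 : tau (dot (W x) y) != 0.
      apply: (contraNN _ k0) => /eqP tk; apply/eqP; exfalso.
      have : tau 1 = 0 by rewrite -(mulVf k0) tauM tk mulr0.
      by rewrite tau1 => /eqP; rewrite oner_eq0.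
    have := E ((dot (W x) y)^-1 *: x); rewrite linearZ dotZl mulVf//.
    rewrite Ttau linearZ dotZl => -[/(_ erefl) + _] => /(congr1 (fun m : R[i] => tau (dot (W x) y) * m)).
    by rewrite mulrA -tauM mulfV// tau1 mul1r mulr1.
  rewrite k0 tau0; apply/eqP/negPn/negP => m0.
  have := E (tau' (dot (W' (T x)) (U y))^-1 *: x).
  rewrite linearZ dotZl k0 mulr0 Ttau tauK linearZ dotZl mulVf//.
  by move=> [_ /(_ erefl)/esym/eqP]; rewrite oner_eq0.
have dotTU x y : dot (T x) (U y) = tau (dot x y).
  by apply: (polar 1 1 1); rewrite ?f1 ?mulr1.
split=> //.
- by move=> c d; rewrite tauD tauN.
- move=> A Ai x.
  have [W' [fW Wf]] : op_invertible (f A) by rewrite -(subr0 (f A)) -f0 -fi subr0.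
  have [W [AW WA]] := Ai.
  (* Both sides have the same product with every [U v], and [U] is onto. *)
  have WT z : W' (T z) = T (W z).
    apply: (@dotl_ext _ _ dot) => w; have [v <-] := Usurj w.
    by rewrite (polar A W W')// dotTU.
  have := WT (A x); rewrite -(opME W A) WA Defs.op1E => <-.
  by rewrite -(opME (f A)) fW.
Qed.

End Spectral.

(** * Conjugation with respect to an orthonormal basis *)

Section Conjugation.
Variables (R : realType) (H : completeNormedModType R[i]).
Variable dot : {dot H for (@Num.conj R[i])}.
Hypothesis Hdot : norm_from_dot dot.
Variables (I : Type) (e : I -> H).
Hypothesis He : orthonormal_basis dot e.
Implicit Types (x y z u v w : H) (a b c : R[i]) (A B : 'B(H)).

(** A relation, since [s] and [c] are not determined by [x]; uniqueness of the conjugate is derived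
    later from inner products. [conj_limit] is the closure of its graph, which avoids expanding
    vectors into infinite sums. *)
Definition conj_pair x x' := exists (s : seq I) (c : I -> R[i]),
  x = \sum_(i <- s) c i *: e i /\ x' = \sum_(i <- s) Num.conj (c i) *: e i.

Definition conj_limit x x' := forall d : R, 0 < d -> exists u u',
  [/\ conj_pair u u', nr (x - u) <= d & nr (x' - u') <= d].

Lemma conj_pair_sym x x' : conj_pair x x' -> conj_pair x' x.
Proof.
move=> [s [c [-> ->]]]; exists s, (fun i => Num.conj (c i)); split=> //.
by apply: eq_bigr => i _; rewrite conjCK.
Qed.

Lemma conj_limit_sym x x' : conj_limit x x' -> conj_limit x' x.
Proof.
by move=> xx' d /xx'[u [u' [/conj_pair_sym uu' xu x'u']]]; exists u', u.
Qed.

Lemma dot_sumr (J : Type) (r : seq J) (F : J -> H) x :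
  dot x (\sum_(i <- r) F i) = \sum_(i <- r) dot x (F i).
Proof. exact: (big_morph _ (fun y z => dotDr dot x y z) (dot0r dot x)). Qed.

Lemma dot_basis_real i j : Num.conj (dot (e i) (e j)) = dot (e i) (e j).
Proof.
have [[e1 e0] _] := He; have [->|ij] := pselect (i = j).
  by rewrite e1 rmorph1.
by rewrite e0// rmorph0.
Qed.

Lemma conj_pair_dot x x' y y' : conj_pair x x' -> conj_pair y y' ->
  dot x' y' = Num.conj (dot x y).
Proof.
move=> [s [c [-> ->]]] [t [d [-> ->]]]; rewrite !dot_suml rmorph_sum.
apply: eq_bigr => i _; rewrite !dot_sumr rmorph_sum; apply: eq_bigr => j _.
by rewrite !dotZl !dotZr !rmorphM /= dot_basis_real.
Qed.

Lemma conj_pair_isometry x x' y y' : conj_pair x x' -> conj_pair y y' ->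
  nr (x' - y') = nr (x - y).
Proof.
move=> xx' yy'; apply/eqP.
rewrite -(eqrXn2 (_ : 0 < 2)%N) ?nr_ge0//; apply/eqP; apply: complexI.
rewrite -!(dotxx Hdot) !(dotBl, dotBr) (conj_pair_dot xx' xx').
rewrite (conj_pair_dot xx' yy') (conj_pair_dot yy' xx') (conj_pair_dot yy' yy').
by rewrite -!dotC; ring.
Qed.

Lemma conj_pair_dense x (d : R) : 0 < d ->
  exists u u', conj_pair u u' /\ nr (x - u) < d.
Proof.
move=> d0; have [_ cl] := He.
have : closure [set x | exists (s : seq I) (c : I -> R[i]),
  x = \sum_(i <- s) c i *: e i] x by rewrite cl.
have dC : 0 < d%:C by rewrite ltcR.
move=> /(_ _ (nbhsx_ballx x _ dC))[_ [[s [c ->]]]].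
rewrite -ball_normE /= nrE ltcR => xd.
exists (\sum_(i <- s) c i *: e i), (\sum_(i <- s) Num.conj (c i) *: e i).
by split=> //; exists s, c.
Qed.

(** Finite approximants of [x] form a Cauchy sequence and conjugation of finite sums is isometric,
    so their conjugates converge. *)
Lemma conj_limit_exists x : exists x', conj_limit x x'.
Proof.
have /choice[u uE] (n : nat) : exists u : H * H,
    conj_pair u.1 u.2 /\ nr (x - u.1) < n.+1%:R^-1.
  have [u [u' [uu' xu]]] : exists u u', conj_pair u u' /\ nr (x - u) < n.+1%:R^-1.
    by apply: conj_pair_dense; rewrite invr_gt0.
  by exists (u, u').
have small (d : R) : 0 < d -> exists N, forall n, (N <= n)%N -> nr (x - (u n).1) < d.
  move=> d0; exists (Num.truncn d^-1).+1 => n Nn.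
  have [_ /lt_trans] := uE n; apply.
  rewrite -[ltRHS]invrK ltf_pV2 ?posrE ?invr_gt0//.
  by rewrite (lt_le_trans (truncnS_gt _))// ler_nat leqW.
have [|l lE] := @complete_seq _ _ (fun n => (u n).2).
  move=> d d0; have d2 : 0 < d / 2 by rewrite divr_gt0.
  have [N NE] := small _ d2; exists N => m n /NE xm /NE xn.
  rewrite (conj_pair_isometry (proj1 (uE m)) (proj1 (uE n))).
  rewrite (le_lt_trans (nr_dist _ x _))// nrB; lra.
exists l => d d0; have [N NE] := small _ d0; have [N' N'E] := lE _ d0.
exists (u (maxn N N')).1, (u (maxn N N')).2; split; first exact: (proj1 (uE _)).
  by rewrite ltW// NE// leq_maxl.
by rewrite ltW// N'E// leq_maxr.
Qed.

Lemma cn_dot_dist x y u v (d : R) : d <= 1 -> nr (x - u) <= d -> nr (y - v) <= d ->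
  cn (dot x y - dot u v) <= d * (nr x + nr y + 1).
Proof.
move=> d1 xu yv; have d0 : 0 <= d by exact: le_trans (nr_ge0 _) xu.
have -> : dot x y - dot u v = dot (x - u) y + dot u (y - v).
  by rewrite dotBl dotBr addrA subrK.
have ux : nr u <= nr x + 1.
  by have := nrD x (u - x); rewrite addrC subrK => /le_trans; apply;
    rewrite lerD2l nrB (le_trans xu).
have h1 := le_trans (cn_dot Hdot (x - u) y) (ler_wpM2r (nr_ge0 y) xu).
have h2 := le_trans (cn_dot Hdot u (y - v))
  (ler_pM (nr_ge0 u) (nr_ge0 _) ux yv).
rewrite (le_trans (cnD _ _))//; move: h1 h2; lra.
Qed.

Lemma conj_limit_dot x x' y y' : conj_limit x x' -> conj_limit y y' ->
  dot x' y' = Num.conj (dot x y).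
Proof.
move=> xx' yy'; apply/eqP; rewrite -subr_eq0 -cn_eq0 eq_le cn_ge0 andbT leNgt.
apply/negP; set C := cn _ => C0.
pose K := nr x + nr y + 1 + (nr x' + nr y' + 1).
have K0 : 0 < K.
  have := nr_ge0 x; have := nr_ge0 y; have := nr_ge0 x'; have := nr_ge0 y'.
  by rewrite /K; lra.
(* The two approximation errors add up to at most [d * K], which is at most [C / 2]. *)
pose d := Num.min 1 (C / (2 * K)).
have d0 : 0 < d by rewrite /d lt_min ltr01 divr_gt0// mulr_gt0.
have d1 : d <= 1 by rewrite /d ge_min lexx.
have dK : d * K <= C / 2.
  have : d <= C / (2 * K) by rewrite /d ge_min lexx orbT.
  by rewrite ler_pdivlMr ?mulr_gt0//; lra.
have [u [u' [uu' xu xu']]] := xx' _ d0.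
have [v [v' [vv' yv yv']]] := yy' _ d0.
have h1 := cn_dot_dist d1 xu yv; have h2 := cn_dot_dist d1 xu' yv'.
have : C <= d * (nr x + nr y + 1) + d * (nr x' + nr y' + 1).
  rewrite addrC /C.
  have -> : dot x' y' - Num.conj (dot x y) =
    (dot x' y' - dot u' v') - Num.conj (dot x y - dot u v).
    by rewrite rmorphB /= (conj_pair_dot uu' vv') opprB addrA subrK.
  by rewrite (le_trans (cnD _ _))// cnN cnJ lerD.
by rewrite -mulrDr -/K; lra.
Qed.

(** All inner products among [x'] and [x''] equal the conjugate of [dot x x], so those of [x' - x'']
    with itself cancel. *)
Lemma conj_limit_uniq x x' x'' : conj_limit x x' -> conj_limit x x'' -> x' = x''.
Proof.
move=> xx' xx''; apply/eqP; rewrite -subr_eq0 -(dotxx_eq0 dot) dotBl !dotBr.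
rewrite (conj_limit_dot xx' xx') (conj_limit_dot xx' xx'').
by rewrite (conj_limit_dot xx'' xx') (conj_limit_dot xx'' xx'') !subrr.
Qed.

Lemma conjugation_exists : exists J : H -> H,
  [/\ forall x y, dot (J x) (J y) = Num.conj (dot x y),
      involutive J & forall i, J (e i) = e i].
Proof.
have /choice[J JE] := conj_limit_exists.
exists J; split=> [x y|x|i]; first exact: conj_limit_dot.
  by apply: conj_limit_uniq (JE (J x)) _; exact: conj_limit_sym.
apply: conj_limit_uniq (JE (e i)) _ => d d0; exists (e i), (e i); split.
- by exists [:: i], (fun=> 1); rewrite !big_seq1 rmorph1 scale1r.
- by rewrite subrr nr0 ltW.
- by rewrite subrr nr0 ltW.
Qed.

End Conjugation.

(** * Conjugation of operators by an antiunitary involution *)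

Section ConjugateOperator.
Variables (R : realType) (H : completeNormedModType R[i]).
Variable dot : {dot H for (@Num.conj R[i])}.
Hypothesis Hdot : norm_from_dot dot.
Variable J : H -> H.
Hypothesis JJ : forall x y, dot (J x) (J y) = Num.conj (dot x y).
Hypothesis JK : involutive J.
Implicit Types (x y z u v w : H) (a b c : R[i]) (A B : 'B(H)).

Lemma dotJl x y : dot (J x) y = Num.conj (dot x (J y)).
Proof. by rewrite -JJ JK. Qed.

Lemma JD x y : J (x + y) = J x + J y.
Proof.
apply: (@dotl_ext _ _ dot) => z.
by rewrite dotDl !dotJl dotDl rmorphD.
Qed.

Lemma JZ c x : J (c *: x) = Num.conj c *: J x.
Proof.
apply: (@dotl_ext _ _ dot) => z.
by rewrite dotZl !dotJl dotZl rmorphM.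
Qed.

Lemma nrJ x : nr (J x) = nr x.
Proof.
apply/eqP; rewrite -(eqrXn2 (_ : 0 < 2)%N) ?nr_ge0//; apply/eqP;
  apply: complexI.
by rewrite -!(dotxx Hdot) JJ -dotC.
Qed.

Lemma conj_op_exists A : exists B : 'B(H), forall x, B x = J (A (J x)).
Proof.
have [M M0 AM] := op_nr_bound A; apply: (@mk_op _ _ _ M) => [a x y|x].
  by rewrite JD JZ linearP JD JZ conjCK.
by rewrite nrJ (le_trans (AM _))// nrJ.
Qed.

(** [J A J], linear because it has two antilinear factors; in an orthonormal basis fixed by [J] its
    matrix has the conjugate entries. *)
Definition conj_op A : 'B(H) := sval (cid (conj_op_exists A)).

Lemma conj_opE A x : conj_op A x = J (A (J x)).
Proof. exact: (svalP (cid (conj_op_exists A))). Qed.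

Lemma conj_opK : involutive conj_op.
Proof. by move=> A; apply: bounded_op_ext => x; rewrite !conj_opE !JK. Qed.

Lemma JN x : J (- x) = - J x.
Proof. by rewrite -scaleN1r JZ rmorphN1 scaleN1r. Qed.

Lemma conj_opB A B : conj_op (A - B) = conj_op A - conj_op B.
Proof.
by apply: bounded_op_ext => x; rewrite !(conj_opE, opBE) JD JN.
Qed.

Lemma conj_opM A B : conj_op (A * B) = conj_op A * conj_op B.
Proof.
by apply: bounded_op_ext => x; rewrite !(conj_opE, opME) JK.
Qed.

Lemma conj_op1 : conj_op 1 = 1.
Proof. by apply: bounded_op_ext => x; rewrite conj_opE !Defs.op1E JK. Qed.

Lemma inv_conj_op A : op_invertible A -> op_invertible (conj_op A).
Proof.
by move=> [B [AB BA]]; exists (conj_op B); rewrite -!conj_opM AB BA conj_op1.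
Qed.

Lemma adj_conj_op A : adj Hdot (conj_op A) = conj_op (adj Hdot A).
Proof.
apply: adj_uniq => x y; rewrite !conj_opE dotJl dot_adj.
by rewrite -[in RHS](JK x) JJ.
Qed.

Lemma inv_pres_conj_op f g : inv_pres f g ->
  inv_pres (f \o conj_op) (conj_op \o g).
Proof.
move=> [fg gf fi]; split=> [A|A|A B] /=;
  rewrite ?fg ?conj_opK ?gf// -fi -conj_opB.
by split=> [/inv_conj_op//|/inv_conj_op]; rewrite conj_opK.
Qed.

End ConjugateOperator.

(** * Classification of the maps with [f 0 = 0] and [f 1 = 1] *)

Section Classification.
Variables (R : realType) (H : completeNormedModType R[i]).
Variable dot : {dot H for (@Num.conj R[i])}.
Hypothesis Hdot : norm_from_dot dot.
Hypothesis Hinf : infinite_dimensional H.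
Variable J : H -> H.
Hypothesis JJ : forall x y, dot (J x) (J y) = Num.conj (dot x y).
Hypothesis JK : involutive J.
Implicit Types (x y z u v w : H) (a b c : R[i]) (A B S : 'B(H)).
Implicit Types (f g : 'B(H) -> 'B(H)).
Local Notation rk1 := (rk1 Hdot).
Local Notation conj_op := (conj_op Hdot JJ JK).

(** The form in which dimension enters the rank-one geometry: [x = 0] gives a nonzero vector, any
    other [x] a second direction. *)
Lemma exists_not_par x : exists y, ~ par x y.
Proof.
have [y yx] := Hinf (fun _ : 'I_1 => x); exists y => -[c yc].
by apply: (yx (fun=> c)); rewrite big_ord1.
Qed.

Lemma classify_shared_row f g y y' : inv_pres f g -> f 0 = 0 -> f 1 = 1 ->
  y != 0 -> y' != 0 -> shared_row Hdot f y y' ->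
  exists S S' : 'B(H), [/\ S * S' = 1, S' * S = 1 &
    (forall A, f A = S * A * S') \/ (forall A, f A = S * conj_op A * S')].
Proof.
move=> fgP f0 f1 y0 y'0 sh; have dim2 := exists_not_par.
have [T [T' [U [tau [tau' [TK T'K Tadd [Ttau T'tau] [TU Usurj]]]]]]] :=
  rk1_structure dim2 fgP f0 y0 y'0 sh.
have [tauB tauM dotTU fT] :=
  intertwine dim2 fgP f0 f1 TK T'K Tadd Ttau T'tau TU Usurj.
pose taum : {rmorphism R[i] -> R[i]} := HB.pack tau
  (GRing.isZmodMorphism.Build _ _ tau tauB) (GRing.isMonoidMorphism.Build _ _ tau tauM).
have [d [M [d0 tauM']]] := locally_bounded_of_semilinear Hdot Hinf dotTU.
have [tauE|tauE] := @locally_bounded_endomorphism R taum d M d0 tauM'.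
  have Tlin : linear T by move=> a x z; rewrite Tadd Ttau [tau a]tauE.
  have TUE x z : dot (T x) (U z) = dot x z by rewrite dotTU [tau _]tauE.
  have [S [S' [SS' S'S fS]]] :=
    similarity_of_weak_adjoint Hdot fgP f0 Tlin TK T'K TUE Usurj fT.
  by exists S, S'; split=> //; left.
(* Here [tau] is the conjugation and [T] is antilinear; precomposing [f] with [conj_op] replaces [T]
   by the linear [T \o J]. *)
have fJP := inv_pres_conj_op Hdot JJ JK fgP.
have fJ0 : (f \o conj_op) 0 = 0.
  rewrite /= (_ : conj_op 0 = 0) ?f0//.
  by rewrite -[in LHS](subrr 0) conj_opB subrr.
have TJlin : linear (T \o J).
  by move=> a x z /=;
    rewrite (JD JJ JK) (JZ JJ JK) Tadd Ttau [tau _]tauE conjCK.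
have TJK : cancel (T \o J) (J \o T') by move=> x /=; rewrite TK JK.
have T'JK : cancel (J \o T') (T \o J) by move=> x /=; rewrite JK T'K.
have TJUE x z : dot ((T \o J) x) ((U \o J) z) = dot x z.
  by rewrite /= dotTU [tau _]tauE JJ conjCK.
have UJsurj w : exists v, (U \o J) v = w.
  by have [v vE] := Usurj w; exists (J v); rewrite /= JK.
have fTJ A : op_invertible A -> forall x,
    (f \o conj_op) A ((T \o J) x) = (T \o J) (A x).
  by move=> /(inv_conj_op Hdot JJ JK)/fT h x; rewrite /= h conj_opE JK.
have [S [S' [SS' S'S fS]]] :=
  similarity_of_weak_adjoint Hdot fJP fJ0 TJlin TJK T'JK TJUE UJsurj fTJ.
exists S, S'; split=> //; right => A.
by rewrite -fS /= conj_opK.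
Qed.

(** Were the columns of the two images parallel, [g], which preserves lines through 0, would make
    [x2] a multiple of [x1]. *)
Lemma shared_row_of_par f g x1 x2 y u1 u2 v1 v2 : inv_pres f g -> f 0 = 0 ->
  indep x1 x2 -> y != 0 -> u1 != 0 -> v1 != 0 -> f (rk1 x1 y) = rk1 u1 v1 ->
  f (rk1 x2 y) = rk1 u2 v2 -> par v1 v2 -> shared_row Hdot f y v1.
Proof.
move=> fgP f0 x12 y0 u10 v10 f1 f2 [c vc].
move: f2; rewrite vc rk1Zr => f2; exists x1, x2, u1, (Num.conj c *: u2);
  split=> //.
split=> // -[d ud]; have [fg _ _] := fgP; have [_] := x12; apply.
have g1 : g (rk1 u1 v1) = rk1 x1 y by rewrite -f1 fg.
have [d'] := line0 exists_not_par (inv_pres_sym fgP) (inv_pres0 fgP f0) d g1.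
by rewrite -ud -f2 fg => /(rk1_injl y0) ->; exists d'.
Qed.

Lemma classify f g : inv_pres f g -> f 0 = 0 -> f 1 = 1 ->
  exists S S' : 'B(H), [/\ op_invertible S, op_invertible S' &
    (forall A, f A = S * A * S') \/ (forall A, f A = S * conj_op A * S') \/
    (forall A, f A = S * adj Hdot A * S') \/
    (forall A, f A = S * conj_op (adj Hdot A) * S')].
Proof.
move=> fgP f0 f1; have dim2 := exists_not_par.
have [y y0] := dim2 0; have {}y0 : y != 0.
  by apply/eqP => yE; apply: y0; rewrite yE; exact: par0.
have [x2 yx2] := dim2 y; have x12 : indep y x2 by [].
have [u1 [v1 [u10 v10 fu1]]] := pres0 Hdot dim2 fgP f0 y0 y0.
have [u2 [v2 [u20 v20 fu2]]] := pres0 Hdot dim2 fgP f0 (indep_neq0r x12) y0.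
have x21 : x2 - y != 0.
  by rewrite subr_eq0; apply/eqP => E; apply: yx2; rewrite E; exact: parxx.
have [p [q [_ _]]] := pres_rk1 Hdot dim2 (rk1 y y) fgP x21 y0.
(* The images of [rk1 y y] and [rk1 x2 y] share a column ([u12]) or a row ([v12]). In the column
   case [f] followed by the adjoint falls under the row case. *)
rewrite -rk1Dl addrC subrK fu1 fu2 => /(sum_rk1 u10 v10)[u12|v12]; last first.
  have sh := shared_row_of_par fgP f0 x12 y0 u10 v10 fu1 fu2 v12.
  have [S [S' [SS' S'S fS]]] := classify_shared_row fgP f0 f1 y0 v10 sh.
  exists S, S'; split; [by exists S'|by exists S|].
  by case: fS => fS; [left|right; left].
have [fg gf fi] := fgP.
have afP : inv_pres (adj Hdot \o f) (g \o adj Hdot).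
  split=> [A|A|A B] /=; rewrite ?adjK ?fg ?gf ?adjK//.
  by rewrite -adjB inv_adjE.
have af0 : (adj Hdot \o f) 0 = 0 by rewrite /= f0 adj0.
have af1 : (adj Hdot \o f) 1 = 1 by rewrite /= f1 adj1.
have au1 : (adj Hdot \o f) (rk1 y y) = rk1 v1 u1 by rewrite /= fu1 adj_rk1.
have au2 : (adj Hdot \o f) (rk1 x2 y) = rk1 v2 u2 by rewrite /= fu2 adj_rk1.
have sh := shared_row_of_par afP af0 x12 y0 v10 u10 au1 au2 u12.
have [S [S' [SS' S'S fS]]] := classify_shared_row afP af0 af1 y0 u10 sh.
exists (adj Hdot S'), (adj Hdot S); split.
- by apply: inv_adj; exists S.
- by apply: inv_adj; exists S'.
right; right; case: fS => fS; [left|right] => A.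
  by rewrite -[LHS](adjK Hdot) -[adj Hdot (f A)]/((adj Hdot \o f) A) fS !adjM mulrA.
rewrite -[LHS](adjK Hdot) -[adj Hdot (f A)]/((adj Hdot \o f) A) fS !adjM mulrA.
by rewrite adj_conj_op.
Qed.

End Classification.

(** * Removing the normalization and identifying the four forms *)

Theorem theorem1p2 (R : realType) (H : completeNormedModType R[i])
    (dot : {dot H for (@Num.conj R[i])}) (Hdot : norm_from_dot dot)
    (Hinf : infinite_dimensional H)
    (I : Type) (e : I -> H) (He : orthonormal_basis dot e)
    (phi : 'B(H) -> 'B(H)) (phi_bij : bijective phi)
    (phi_inv : forall A B : 'B(H),
      op_invertible (A - B) <-> op_invertible (phi A - phi B)) :
  exists R0 T S : 'B(H), op_invertible T /\ op_invertible S /\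
    ((forall A, phi A = T * A * S + R0) \/
     (forall A, exists At, is_transpose dot e A At /\ phi A = T * At * S + R0) \/
     (forall A, exists Aa, is_adjoint dot A Aa /\ phi A = T * Aa * S + R0) \/
     (forall A, exists At Ata, is_transpose dot e A At /\ is_adjoint dot At Ata /\
        phi A = T * Ata * S + R0)).
Proof.
have [psi phiK psiK] := phi_bij.
have [J [JJ JK Je]] := conjugation_exists Hdot He.
have [G' [GG' G'G]] : op_invertible (phi 1 - phi 0).
  by rewrite -phi_inv subr0; exact: inv1.
set G := phi 1 - phi 0 in GG' G'G.
have Gi : op_invertible G by exists G'.
pose f A := G' * (phi A - phi 0); pose g A := psi (G * A + phi 0).
have fgP : inv_pres f g.
  split=> [A|A|A B]; rewrite /f /g.
  - by rewrite mulrA GG' mul1r subrK phiK.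
  - by rewrite psiK addrK mulrA G'G mul1r.
  - rewrite -mulrBr (invMl _ G'G GG') phi_inv.
    by rewrite opprB addrA subrK.
have phiE A : phi A = G * f A + phi 0 by rewrite /f mulrA GG' mul1r subrK.
have f0 : f 0 = 0 by rewrite /f subrr mulr0.
have f1 : f 1 = 1 by rewrite /f -/G.
have [S [S' [Si S'i fE]]] := classify Hdot Hinf JJ JK fgP f0 f1.
(* The transpose is [J A^* J] because [J] fixes the basis vectors. *)
have tr A : is_transpose dot e A (conj_op Hdot JJ JK (adj Hdot A)).
  by move=> i j; rewrite conj_opE (dotJl JJ JK) !Je adj_dot -dotC.
exists (phi 0), (G * S), S'; split; first exact: invM.
split=> //; case: fE => [fE|[fE|[fE|fE]]].
- by left => A; rewrite phiE fE !mulrA.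
(* The adjoint of [J A^* J] is [J A J], so the branch with [conj_op A] is the last alternative. *)
- right; right; right => A.
  exists (conj_op Hdot JJ JK (adj Hdot A)), (conj_op Hdot JJ JK A); split=> //.
  split; last by rewrite phiE fE !mulrA.
  by move=> x y; rewrite dot_adj adj_conj_op adjK.
- right; right; left => A; exists (adj Hdot A).
  by split; [exact: adjP|rewrite phiE fE !mulrA].
- by right; left => A; eexists; split; [exact: tr|rewrite phiE fE !mulrA].
Qed.
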